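(* Let $\Sigma=(\mathbb R^n,\mathbb W,\mathsf W,\mathbb U,\mathsf U_\tau,f,g,\mathbb Y,h,\Omega)$ be a (sampled-data) nonlinear impulsive subsystem with jump parameters $\tau>0$ and $\underline z\le\overline z$ in $\mathbb N_{\ge1}$, let $T_\tau(\Sigma)$ be its associated transition system, and let $\hat T_\tau(\Sigma)$ be its symbolic model with quantization parameters $\eta^x,\eta^\omega,\eta^u$. Suppose: (A1) there is $L>0$ with $\|h(x)-h(y)\|\le L\|x-y\|$ for all $x,y\in\mathbb R^n$; (A2) there exist a locally Lipschitz function $V:\mathbb R^n\times\mathbb R^n\to\mathbb R_{\ge0}$, functions $\underline\alpha,\overline\alpha,\rho_{\omega_c},\rho_{\omega_d},\rho_{u_c},\rho_{u_d}\in\mathcal K_\infty$ and constants $\kappa_c,\kappa_d\in\mathbb R$ such that - for all $x,\hat x\in\mathbb R^n$: $\underline\alpha(\|x-\hat x\|)\le V(x,\hat x)\le\overline\alpha(\|x-\hat x\|)$; - for almost every $x,\hat x\in\mathbb R^n$, all $\omega,\hat\omega\in\mathbb W$ and all $u,\hat u\in\mathbb U$: $$\frac{\partial V(x,\hat x)}{\partial x}f(x,\omega,u)+\frac{\partial V(x,\hat x)}{\partial\hat x}f(\hat x,\hat\omega,\hat u)\le-\kappa_cV(x,\hat x)+\rho_{\omega_c}(\|\omega-\hat\omega\|)+\rho_{u_c}(\|u-\hat u\|);$$ - for all $x,\hat x\in\mathbb R^n$, $\omega,\hat\omega\in\mathbb W$, $u,\hat u\in\mathbb U$: $$V(g(x,\omega,u),g(\hat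 x,\hat\omega,\hat u))\le\kappa_dV(x,\hat x)+\rho_{\omega_d}(\|\omega-\hat\omega\|)+\rho_{u_d}(\|u-\hat u\|);$$ (A3) there is $\hat\gamma\in\mathcal K_\infty$ with $V(x,y)\le V(x,z)+\hat\gamma(\|y-z\|)$ for all $x,y,z\in\mathbb R^n$. If the inequality $$\ln(\kappa_d)-\kappa_c\tau c<0$$ holds for $c\in\{\underline z,\overline z\}$, then the function $\mathcal V$ defined as $$\mathcal V((x,c),(\hat x,c)):=\begin{cases}V(x,\hat x)&\text{if }\kappa_d<1\ \text{and}\ \kappa_c>0,\\[2pt] \dfrac{V(x,\hat x)}{e^{-\kappa_c\tau\epsilon c}}&\text{if }\kappa_d\ge1\ \text{and}\ \kappa_c>0,\\[6pt] \dfrac{V(x,\hat x)}{\kappa_d^{-c/\delta}}&\text{if }\kappa_d<1\ \text{and}\ \kappa_c\le0,\end{cases}$$ for some $0<\epsilon<1$ and $\delta>\overline z$, is an alternating simulation function from $\hat T_\tau(\Sigma)$ to $T_\tau(\Sigma)$.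
   Context: **Notation.** $\|\cdot\|$ (and $|\cdot|$ on vectors) is the infinity norm; $\|u\|_\infty=\sup_t\|u(t)\|$ for signals. $\mathcal K_\infty$ is the set of continuous, strictly increasing, unbounded $\alpha:\mathbb R_{\ge0}\to\mathbb R_{\ge0}$ with $\alpha(0)=0$. $\mathbf x({}^-t)$ denotes the left limit at $t$. For a set $S$ and $\eta\ge0$, $[S]_\eta=\{a\in S: a_i=k_i\eta,\ k_i\in\mathbb Z \text{ for every coordinate } i\}$ if $\eta\ne0$, and $[S]_0=S$ (for $S$ a finite union of boxes, $\eta$ does not exceed the smallest side length). **Impulsive subsystem.** In $\Sigma=(\mathbb R^n,\mathbb W,\mathsf W,\mathbb U,\mathsf U_\tau,f,g,\mathbb Y,h,\Omega)$: $\mathbb W\subseteq\mathbb R^q$ is the internal input set; $\mathsf W$ is the set of measurable bounded internal input functions $\omega:\mathbb R_{\ge0}\to\mathbb W$ (assumed right-continuous); $\mathbb U\subseteq\mathbb R^m$ is the external input set; $f,g:\mathbb R^n\times\mathbb W\times\mathbb U\to\mathbb R^n$ are locally Lipschitz; $\mathbb Y\subseteq\mathbb R^p$ is the output set; $h:\mathbb R^n\to\mathbb Y$ is the output map; $\Omega=\{t^k\}_{k\in\mathbb N}$ is a strictly increasing sequence of impulse times with $t^{k+1}-t^k\in\{\underline z\tau,\dots,\overline z\tau\}$. The dynamics are $\dot{\mathbf x}(t)=f(\mathbf x(t),\omega(t),\nu(t))$ for $t\notin\Omega$, $\mathbf x(t)=g(\mathbf x({}^-t),\omega({}^-t),\nu(t))$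 for $t\in\Omega$, $\mathbf y(t)=h(\mathbf x(t))$. External inputs are sampled: $\mathsf U_\tau$ is the set of $\nu:\mathbb R_{\ge0}\to\mathbb U$ with $\nu(t)=\nu((k-1)\tau)$ for $t\in[(k-1)\tau,k\tau)$, $k\in\mathbb N_{\ge1}$. It is assumed that there is a constant $\varphi$ such that every $\omega\in\mathsf W$ satisfies $\|\omega(t)-\omega((k-1)\tau)\|\le\varphi$ for all $t\in[(k-1)\tau,k\tau)$, $k\in\mathbb N_{\ge1}$. $\mathbf x_{x,\omega,u}(t)$ denotes the point reached at time $t$ from initial state $x$ under input signals $\omega$ and $u$; in the flow scenarios below this is along $\dot{\mathbf x}=f(\mathbf x,\omega,u)$. **Transition system.** A tuple $(X,X_0,W,\mathcal W,U,\mathcal U,\mathcal F,Y,\mathcal H)$: states, initial states, internal input values and signals, external input values and signals, a set-valued transition function $\mathcal F:X\times\mathcal W\times\mathcal U\rightrightarrows X$, output set, and output map $\mathcal H:X\to Y$. **$T_\tau(\Sigma)$.** $X=\mathbb R^n\times\{0,\dots,\overline z\}$, $X_0=\mathbb R^n\times\{0\}$, $U=\mathbb U$, $\mathcal U=\mathsf U_\tau$, $W=\mathbb W$, $\mathcal W=\mathsf W$, $Y=\mathbb Y$, $\mathcal H(x,c)=h(x)$, and $(x^+,c^+)\in\mathcal F((x,c),\omega,u)$ iff one of the following holds: (flow) $0\le c\le\overline z-1$, $x^+=\mathbf x_{x,\omega,u}({}^-\tau)$, $c^+=c+1$; (jump) $\underline z\le c\le\overline z$, $x^+=g(x,\omega(0),u(0))$,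 $c^+=0$. **$\hat T_\tau(\Sigma)$.** $\hat X=[\mathbb R^n]_{\eta^x}\times\{0,\dots,\overline z\}$, $\hat X_0=[\mathbb R^n]_{\eta^x}\times\{0\}$, $\hat W=[\mathbb W]_{\eta^\omega}$, $\hat U=[\mathbb U]_{\eta^u}$; $\hat{\mathcal W}$ and $\hat{\mathcal U}$ are the sets of signals on $[0,\tau]$ with values in $\hat W$, respectively $\hat U$, that are restrictions of signals constant on each interval $[(k-1)\tau,k\tau)$; $\hat Y=Y$, $\hat{\mathcal H}=\mathcal H$; and $(\hat x^+,c^+)\in\hat{\mathcal F}((\hat x,c),\hat\omega,\hat u)$ iff one of the following holds: (flow) $0\le c\le\overline z-1$, $|\hat x^+-\mathbf x_{\hat x,\hat\omega,\hat u}(\tau)|\le\eta^x$, $c^+=c+1$; (jump) $\underline z\le c\le\overline z$, $|\hat x^+-g(\hat x,\hat\omega(0),\hat u(0))|\le\eta^x$, $c^+=0$. An input value is identified with the constant input curve on $[0,\tau)$ having that value. **Alternating simulation function for transition subsystems with internal inputs (local alternating simulation function).** For $T=(X,X_0,W,\mathcal W,U,\mathcal U,\mathcal F,Y,\mathcal H)$ and $\hat T=(\hat X,\hat X_0,\hat W,\hat{\mathcal W},\hat U,\hat{\mathcal U},\hat{\mathcal F},\hat Y,\hat{\mathcal H})$ with $\hat Y\subseteq Y$ and $\hat W\subseteq W$, a function $\mathcal S:X\times\hat X\to\mathbb R_{\ge0}$ is one from $\hat T$ to $T$ if there exist $\alpha,\bar\rho_\omega\in\mathcal K_\infty$, $0<\bar\sigma<1$,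 $\bar\rho_u\in\mathcal K_\infty\cup\{0\}$ and $\bar\varepsilon\in\mathbb R_{\ge0}$ such that (writing $s\in X$, $\hat s\in\hat X$ for states): (1) for every $s\in X$, $\hat s\in\hat X$: $\alpha(\|\mathcal H(s)-\hat{\mathcal H}(\hat s)\|)\le\mathcal S(s,\hat s)$; (2) for every $s\in X$, $\hat s\in\hat X$, $\hat u\in\hat U$ there exists $u\in U$ such that for every $\omega\in W$, $\hat\omega\in\hat W$, $s^+\in\mathcal F(s,\omega,u)$ there exists $\hat s^+\in\hat{\mathcal F}(\hat s,\hat\omega,\hat u)$ with $$\mathcal S(s^+,\hat s^+)\le\bar\sigma\,\mathcal S(s,\hat s)+\bar\rho_\omega(\|\omega-\hat\omega\|)+\bar\rho_u(\|\hat u\|_\infty)+\bar\varepsilon.$$ Here $\mathcal S=\mathcal V$, whose formula is given for pairs $((x,c),(\hat x,c))$ with a common counter $c$; the conditions refer to the pairs where $\mathcal V$ is given. *)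

(* Defs.v *)
From HB Require Import structures.
From mathcomp Require Import all_boot all_order all_algebra.
From mathcomp Require Import all_classical all_reals all_analysis.

Set Implicit Arguments.
Unset Strict Implicit.
Unset Printing Implicit Defensive.

Import Order.TTheory GRing.Theory Num.Theory.
Import numFieldNormedType.Exports.

Local Open Scope classical_set_scope.
Local Open Scope ring_scope.

(* Vectors of R^k are row vectors 'rV[R]_k, whose library norm `|x| is the
   infinity norm.  A signal R_{>=0} -> R^k is a function R -> 'rV[R]_k of which
   only the values at t >= 0 matter; an input value v is identified with the
   constant signal cst v. *)

Section comparison_functions.
Variable R : realType.

Definition Kinf (a : R -> R) : Prop :=
  [/\ {within `[0, +oo[%classic, continuous a},
      a 0 = 0,
      (forall r s, 0 <= r -> r < s -> a r < a s) &
      (forall M, exists2 r, 0 <= r & M < a r)].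

Definition signal_norm k (v : R -> 'rV[R]_k) : R :=
  sup [set `|v t| | t in `[0, +oo[%classic].

End comparison_functions.

Section lebesgue_null_sets.
Variable R : realType.

(* Lebesgue null sets of R^k (zero outer measure): for every e > 0 there is an
   at most countable cover by boxes [a j, b j], j ranging over P, of total
   volume at most e. *)
Definition null_set k (A : set 'rV[R]_k) : Prop :=
  forall e : R, 0 < e ->
  exists (P : pred nat) (a b : nat -> 'rV[R]_k),
  [/\ (forall j i, a j ord0 i <= b j ord0 i),
      A `<=` \bigcup_(j in [set j | P j])
               [set z | forall i, a j ord0 i <= z ord0 i <= b j ord0 i] &
      (\sum_(0 <= j <oo | P j)
         (\prod_(i < k) (b j ord0 i - a j ord0 i))%:E <= e%:E)%E].

Definition almost_every_pair n (Q : 'rV[R]_n -> 'rV[R]_n -> Prop) : Prop :=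
  null_set [set row_mx z.1 z.2 | z in [set z | ~ Q z.1 z.2]].

End lebesgue_null_sets.

Section transition_systems.
Variable R : realType.

Record transition_system (St : Type) (q m p : nat) := TransitionSystem {
  ts_X : set St;
  ts_X0 : set St;
  ts_W : set 'rV[R]_q;
  ts_Wsig : set (R -> 'rV[R]_q);
  ts_U : set 'rV[R]_m;
  ts_Usig : set (R -> 'rV[R]_m);
  ts_F : St -> (R -> 'rV[R]_q) -> (R -> 'rV[R]_m) -> set St;
  ts_Y : set 'rV[R]_p;
  ts_H : St -> 'rV[R]_p
}.

(* D is the set of pairs at which S is given: the conditions are imposed at the
   pairs in D, and the successor pair for which S is evaluated must lie in D. *)
Definition local_alternating_simulation (St Sth : Type) (q m p : nat)
    (Th : transition_system Sth q m p) (T : transition_system St q m p)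
    (D : St -> Sth -> Prop) (S : St -> Sth -> R) : Prop :=
  [/\ ts_Y Th `<=` ts_Y T,
      ts_W Th `<=` ts_W T,
      (forall s sh, ts_X T s -> ts_X Th sh -> D s sh -> 0 <= S s sh) &
      exists (alpha rhow rhou : R -> R) (sigma eps : R),
      [/\ [/\ Kinf alpha, Kinf rhow, 0 < sigma < 1,
              Kinf rhou \/ (forall r, rhou r = 0) & 0 <= eps],
          (forall s sh, ts_X T s -> ts_X Th sh -> D s sh ->
             alpha `|ts_H T s - ts_H Th sh| <= S s sh) &
          (forall s sh uh, ts_X T s -> ts_X Th sh -> D s sh -> ts_U Th uh ->
             exists2 u, ts_U T u &
             forall w wh s', ts_W T w -> ts_W Th wh ->
             ts_F T s (cst w) (cst u) s' ->
             exists sh',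
             [/\ ts_F Th sh (cst wh) (cst uh) sh',
                 D s' sh' &
                 S s' sh' <= sigma * S s sh + rhow `|w - wh|
                             + rhou (signal_norm (cst uh)) + eps])]].

End transition_systems.

Section impulsive_subsystems.
Variable R : realType.

Definition sampled_signals (tau : R) k (A : set 'rV[R]_k) :
    set (R -> 'rV[R]_k) :=
  [set v | (forall t, 0 <= t -> A (v t)) /\
           (forall j t, (1 <= j)%N ->
              j.-1%:R * tau <= t < j%:R * tau -> v t = v (j.-1%:R * tau))].

Record impulsive_subsystem (n q m p : nat) := ImpulsiveSubsystem {
  is_W : set 'rV[R]_q;
  is_Wsig : set (R -> 'rV[R]_q);
  is_U : set 'rV[R]_m;
  is_f : 'rV[R]_n -> 'rV[R]_q -> 'rV[R]_m -> 'rV[R]_n;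
  is_g : 'rV[R]_n -> 'rV[R]_q -> 'rV[R]_m -> 'rV[R]_n;
  is_Y : set 'rV[R]_p;
  is_h : 'rV[R]_n -> 'rV[R]_p;
  is_Omega : nat -> R
}.

(* f and g matter only on R^n x W x U; the set of external signals is
   sampled_signals tau (is_U S). *)
Definition locally_lipschitz_dynamics n q m
    (W : set 'rV[R]_q) (U : set 'rV[R]_m)
    (f : 'rV[R]_n -> 'rV[R]_q -> 'rV[R]_m -> 'rV[R]_n) : Prop :=
  [locally [lipschitz f z.1.1 z.1.2 z.2 |
              z in ([set: 'rV[R]_n] `*` W) `*` U]].

Definition sampled_impulsive_subsystem (tau : R) (zlo zhi : nat) n q m p
    (S : impulsive_subsystem n q m p) : Prop :=
  [/\ (forall w, is_Wsig S w ->
         [/\ (forall t, 0 <= t -> is_W S (w t)),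
             (forall i, measurable_fun (`[0, +oo[%classic : set R) (fun t => w t ord0 i : R)),
             (exists M, forall t, 0 <= t -> `|w t| <= M) &
             (forall t, 0 <= t -> w s @[s --> t^'+] --> w t)])
      /\ (exists phi : R, forall w, is_Wsig S w ->
            forall j t, (1 <= j)%N -> j.-1%:R * tau <= t < j%:R * tau ->
            `|w t - w (j.-1%:R * tau)| <= phi),
      locally_lipschitz_dynamics (is_W S) (is_U S) (is_f S),
      locally_lipschitz_dynamics (is_W S) (is_U S) (is_g S),
      (forall x, is_Y S (is_h S x)) &
      (forall k, is_Omega S k < is_Omega S k.+1) /\
      (forall k, exists2 z : nat, (zlo <= z <= zhi)%N &
         is_Omega S k.+1 - is_Omega S k = z%:R * tau)].

(* Caratheodory solutions of x' = f(x, w, u), x(0) = x0 on an interval I of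
   R_{>=0} starting at 0, the signal w being merely measurable in general. *)
Definition flow_on n q m p (S : impulsive_subsystem n q m p) (I : set R)
    (x0 : 'rV[R]_n) (w : R -> 'rV[R]_q) (u : R -> 'rV[R]_m)
    (x : R -> 'rV[R]_n) : Prop :=
  {within I, continuous x} /\
  forall t, I t -> forall i,
    (@lebesgue_measure R).-integrable `[0, t]
      (EFin \o (fun s => is_f S (x s) (w s) (u s) ord0 i)) /\
    x t ord0 i = x0 ord0 i +
      (\int[@lebesgue_measure R]_(s in `[0, t])
         is_f S (x s) (w s) (u s) ord0 i)%R.

Definition T_tau (tau : R) (zlo zhi : nat) n q m p
    (S : impulsive_subsystem n q m p) :
    transition_system R ('rV[R]_n * nat) q m p :=
  {| ts_X := [set s | (s.2 <= zhi)%N];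
     ts_X0 := [set s | s.2 = 0%N];
     ts_W := is_W S;
     ts_Wsig := is_Wsig S;
     ts_U := is_U S;
     ts_Usig := sampled_signals tau (is_U S);
     ts_F := fun s w u => [set s' |
       ([/\ (s.2 <= zhi - 1)%N,
            (exists2 x, flow_on S `[0, tau[ s.1 w u x &
                        x t @[t --> tau^'-] --> s'.1) &
            s'.2 = (s.2 + 1)%N])
       \/
       ([/\ (zlo <= s.2 <= zhi)%N,
            s'.1 = is_g S s.1 (w 0) (u 0) &
            s'.2 = 0%N])];
     ts_Y := is_Y S;
     ts_H := fun s => is_h S s.1 |}.

Definition quantize k (A : set 'rV[R]_k) (eta : R) : set 'rV[R]_k :=
  if eta == 0 then A
  else [set a | A a /\ forall i, exists z : int, a ord0 i = z%:~R * eta].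

Definition sampled_signals_upto (tau : R) k (A : set 'rV[R]_k) :
    set (R -> 'rV[R]_k) :=
  [set v | exists2 v', sampled_signals tau A v' &
           forall t, 0 <= t <= tau -> v t = v' t].

Definition That_tau (tau : R) (zlo zhi : nat) (etax etaw etau : R) n q m p
    (S : impulsive_subsystem n q m p) :
    transition_system R ('rV[R]_n * nat) q m p :=
  let grid := quantize [set: 'rV[R]_n] etax in
  {| ts_X := [set s | grid s.1 /\ (s.2 <= zhi)%N];
     ts_X0 := [set s | grid s.1 /\ s.2 = 0%N];
     ts_W := quantize (is_W S) etaw;
     ts_Wsig := sampled_signals_upto tau (quantize (is_W S) etaw);
     ts_U := quantize (is_U S) etau;
     ts_Usig := sampled_signals_upto tau (quantize (is_U S) etau);
     ts_F := fun s w u => [set s' | grid s'.1 /\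
       (([/\ (s.2 <= zhi - 1)%N,
             (exists2 x, flow_on S `[0, tau] s.1 w u x &
                         `|s'.1 - x tau| <= etax) &
             s'.2 = (s.2 + 1)%N])
        \/
        ([/\ (zlo <= s.2 <= zhi)%N,
             `|s'.1 - is_g S s.1 (w 0) (u 0)| <= etax &
             s'.2 = 0%N]))];
     ts_Y := is_Y S;
     ts_H := fun s => is_h S s.1 |}.

(* The formula covers pairs with a common counter.  The remaining case
   kd >= 1 and kc <= 0 is excluded by ln kd - kc * tau * c < 0 and gets the
   dummy value 0.  For kd <= 0 the library's ln kd is 0, so that inequality then
   forces 0 < kc and only the first branch, free of ln and powR, is reached. *)
Definition calV n (V : 'rV[R]_n -> 'rV[R]_n -> R) (kc kd tau epsilon delta : R)
    (s sh : 'rV[R]_n * nat) : R :=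
  if (kd < 1) && (0 < kc) then V s.1 sh.1
  else if (1 <= kd) && (0 < kc) then
    V s.1 sh.1 / expR (- kc * tau * epsilon * s.2%:R)
  else if (kd < 1) && (kc <= 0) then
    V s.1 sh.1 / kd `^ (- (s.2%:R / delta))
  else 0.

Definition same_counter n (s sh : 'rV[R]_n * nat) : Prop := s.2 = sh.2.

End impulsive_subsystems.

(* Main.v *)
Require Import Defs.
From HB Require Import structures.
From mathcomp Require Import all_boot all_order all_algebra.
From mathcomp Require Import all_classical all_reals all_analysis.
From mathcomp Require Import measurable_realfun ring lra.
Set Implicit Arguments.
Unset Strict Implicit.
Unset Printing Implicit Defensive.
Import Order.TTheory GRing.Theory Num.Theory.
Import numFieldNormedType.Exports.
Local Open Scope classical_set_scope.
Local Open Scope ring_scope.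

(** In all three regimes the simulation function is [V * e^(a c)] for a suitable
rate [a]: [0], [kc tau epsilon] or [ln kd / delta].  A flow step multiplies it by
at most [e^(a - kc tau)] and a jump from counter [c] by at most [kd e^(- a c)];
the dwell-time inequalities leave room to choose [epsilon] or [delta] so that both
factors are below 1.  The concrete system is driven by the abstract input itself, so
no external-input gain is needed.

For the flow step, the dissipation inequality holds only almost everywhere while
the trajectories may stay in the exceptional null set.  Since [V] is locally
Lipschitz, the inequality nevertheless holds at every point for the one-sided
slope of [V] along the vector field: by Tonelli, arbitrarily close to any segment
there is a parallel one meeting the null set in small length, and along it the
increment of [V] is controlled up to that length.  A Dini-derivative comparison
then gives exponential decay along pairs of trajectories.  Completeness of the
symbolic flow is not assumed: the decay estimate confines it to a bounded
neighbourhood of the concrete trajectory, so a truncated, globally Lipschitz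
vector field has the same solution, which the Picard iteration provides. *)

(** * One-sided slopes and comparison *)

Lemma within_continuousP (R : realType) (T : normedModType R) (A : set R) (f : R -> T) :
  {within A, continuous f} <->
  forall t, A t -> f s @[s --> within A (nbhs t)] --> f t.
Proof. exact: subspace_continuousP. Qed.

(** Turns a directional derivative into the one-sided upper slope form in which all later estimates
    are stated; this form survives at points where no derivative exists. *)
Lemma derivable_right_slope (R : realType) (U : normedModType R) (f : U -> R^o)
    (a v : U) (l : R) : is_derive a v f l ->
  forall e, 0 < e -> \forall h \near 0^'+, f (a + h *: v) <= f a + h * (l + e).
Proof.
move=> [df fl] e e0.
have := df; rewrite /derivable => /cvg_ex[l' fl'].
have E : l' = l by rewrite -fl /derive; apply/esym/cvg_lim.
rewrite {}E {l'} in fl'.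
have /cvgrPdist_le /(_ _ e0) H : (h^-1 *: (f (h *: v + a) - f a)) @[h --> 0^'+] --> l.
  apply: cvg_trans fl'; apply: cvg_app; apply: within_subset.
  by move=> h /= h0; rewrite gt_eqF.
near=> h.
have h0 : 0 < h by near: h; exact: nbhs_right_gt.
have : `|l - h^-1 *: (f (h *: v + a) - f a)| <= e by near: h.
rewrite [X in `|_ - X|]/GRing.scale/= ler_distlC => /andP[_].
by rewrite mulrC ler_pdivrMr// [h *: v + a]addrC lerBlDl mulrC.
Unshelve. all: by end_near. Qed.

(** For each rate [e], consider the supremum [s] of the times at which [psi] lies below the line of
    slope [e] from [psi a]. Continuity puts [s] in this set, and [step] moves past it unless
    [s = b]; then [e] tends to 0. *)
Lemma dini_nonincreasing (R : realType) (psi : R -> R) (a b : R) :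
  a <= b -> {within `[a, b], continuous psi} ->
  (forall t e, a <= t < b -> 0 < e ->
     exists2 t', t < t' <= b & psi t' <= psi t + (t' - t) * e) ->
  psi b <= psi a.
Proof.
move=> ab /(@within_continuousP _ R^o) cpsi step; apply/ler_addgt0Pr => e0 e0_gt0.
set e := e0 / (b - a + 1).
have ba0 : 0 < b - a + 1 by lra.
have e_gt0 : 0 < e by rewrite divr_gt0.
suff : psi b <= psi a + (b - a) * e.
  move=> /le_trans; apply; rewrite lerD2l /e mulrA ler_pdivrMr//.
  by rewrite [leRHS]mulrC ler_pM2r//; lra.
pose S := [set t | a <= t <= b /\ psi t <= psi a + (t - a) * e].
have Sa : S a by split; [rewrite lexx|rewrite subrr mul0r addr0].
have hS : has_sup S by split; [exists a|exists b => t [/andP[]]].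
set s := sup S.
have as_ : a <= s by apply: ub_le_sup => //; case: hS.
have sb : s <= b by apply: ge_sup; [exists a|move=> t [/andP[]]].
have Ss : S s.
  split; first by rewrite as_.
  rewrite leNgt; apply/negP => lt.
  have sI : `[a, b]%classic s by rewrite /= in_itv/= as_ sb.
  have /cvgrPdist_lt := cpsi s sI.
  set d := psi s - (psi a + (s - a) * e).
  have d0 : 0 < d by rewrite subr_gt0.
  move=> /(_ _ d0); rewrite near_withinE => /nbhs_ballP[r /= r0 H].
  have [t St rt] := sup_adherent r0 hS.
  have ts : t <= s by apply: ub_le_sup => //; case: hS.
  have [/andP[at_ tb] Ht] := St.
  have := H t; rewrite /ball/= in_itv/= at_ tb ger0_norm ?subr_ge0//.
  have -> : s - t < r by rewrite -/s in rt; lra.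
  move=> /(_ isT isT); rewrite ltr_norml => /andP[_].
  apply/negP; rewrite -leNgt /d.
  have : (t - a) * e <= (s - a) * e by rewrite ler_pM2r//; lra.
  lra.
have [sb'|bs] := ltP s b; last first.
  have -> : b = s by apply/eqP; rewrite eq_le bs sb.
  by case: Ss.
have [|t' /andP[st' t'b] H] := step s e _ e_gt0; first by rewrite as_.
have : S t'.
  split; first by rewrite t'b andbT (le_trans as_)// ltW.
  apply: (le_trans H); case: Ss => _ Ss.
  have -> : (t' - a) * e = (s - a) * e + (t' - s) * e by ring.
  lra.
move=> /(ub_le_sup hS.2); rewrite -/s; lra.
Qed.

(** Integrating factor: [e^(k t) y] minus a linear term has nonpositive right slope. The constant
    [E = e^(|k| T)] bounds both the weight [e^(k t)] and the final factor [e^(- k T)] whatever the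
    sign of [k], whence its square. *)
Lemma exp_comparison (R : realType) (y : R -> R) (k rho T : R) :
  0 <= T -> 0 <= rho -> {within `[0, T], continuous y} ->
  (forall t e, 0 <= t < T -> 0 < e ->
     \forall h \near 0^'+, y (t + h) <= y t + h * (- k * y t + rho + e)) ->
  y T <= expR (- k * T) * y 0 + rho * (T * expR (`|k| * T) ^+ 2).
Proof.
move=> T0 rho0 cy slope; set E := expR (`|k| * T).
have E0 : 0 < E by exact: expR_gt0.
pose psi t := expR (k * t) * y t - rho * E * t.
have : psi T <= psi 0.
  apply: dini_nonincreasing => //.
    apply/(@within_continuousP _ R^o) => t tT; apply: cvgB; last first.
      apply: cvg_within_filter; apply: cvgMr; exact: cvg_id.
    apply: cvgM; last by move/(@within_continuousP _ R^o): cy; apply.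
    apply: cvg_within_filter; apply: continuous_comp; last exact: continuous_expR.
    by apply: cvgMr; exact: cvg_id.
  move=> t e /andP[t0 tT] e0.
  set e1 := e / 2 / E; have e1_gt0 : 0 < e1 by rewrite !divr_gt0.
  set c := - k * y t + rho + e1.
  (* [y] may fail to be differentiable, so it is replaced by its affine upper bound in [h]. In the
     derivative of [q] at 0 the term [- k * y t] cancels against the derivative of the weight. *)
  pose q h := expR (k * (t + h)) * (y t + h * c).
  have dq : is_derive (0 : R) 1 q (expR (k * t) * (rho + e1)).
    rewrite /q; apply: is_derive_eq.
    rewrite /GRing.scale/= !add0r !mul0r !addr0 /c; ring.
  have e2_gt0 : 0 < e / 2 by rewrite divr_gt0.
  have Hq := derivable_right_slope dq e2_gt0.
  near (0 : R)^'+ => h.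
  have h0 : 0 < h by near: h; exact: nbhs_right_gt.
  have hT : h < T - t by near: h; apply: nbhs_right_lt; rewrite subr_gt0.
  exists (t + h); first lra.
  have Hy : y (t + h) <= y t + h * c by near: h; apply: slope; rewrite ?t0.
  have : q (0 + h *: 1) <= q 0 + h * (expR (k * t) * (rho + e1) + e / 2) by near: h.
  rewrite /q /GRing.scale/= mulr1 !add0r mul0r !addr0 => Hqh.
  have EE : expR (k * t) <= E.
    rewrite ler_expR; apply: le_trans (ler_wpM2l _ (ltW tT)) => //.
    by rewrite ler_wpM2r// ler_norm.
  rewrite /psi.
  have H1 : expR (k * (t + h)) * y (t + h) <= expR (k * (t + h)) * (y t + h * c).
    by rewrite ler_pM2l// expR_gt0.
  have H2 : expR (k * t) * (rho + e1) <= rho * E + e / 2.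
    have -> : rho * E + e / 2 = E * (rho + e1) by rewrite /e1; field; rewrite gt_eqF.
    by rewrite ler_wpM2r// addr_ge0// ltW.
  have H3 : h * (expR (k * t) * (rho + e1) + e / 2) <= h * (rho * E + e).
    by rewrite ler_pM2l//; lra.
  have -> : (t + h - t) * e = h * e by ring.
  lra.
rewrite /psi mulr0 mulr0 expR0 mul1r subr0 lerBlDr => H.
have -> : y T = expR (- k * T) * (expR (k * T) * y T).
  by rewrite mulrA -expRD -mulrDl addNr mul0r expR0 mul1r.
apply: le_trans (ler_wpM2l (expR_ge0 _) H) _.
rewrite mulrDr lerD2l.
have : expR (- k * T) <= E.
  by rewrite ler_expR ler_wpM2r// (le_trans (ler_norm _))// normrN.
move=> EE; rewrite expr2.
have -> : rho * (T * (E * E)) = E * (rho * E * T) by ring.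
by rewrite ler_wpM2r// !mulr_ge0// ltW.
Unshelve. all: by end_near. Qed.

(** * Null sets and parallel segments *)

Section strips.
Variable R : realType.
Local Notation mu := (@lebesgue_measure R).
(* [lebesgue_measure] lives on [measurableTypeR R], whose product sigma-algebra is
   not inferred from [R * R]. *)
Local Notation RR := (measurableTypeR R * measurableTypeR R)%type.
Local Notation strip E v a b :=
  [set z : RR | E z.2 /\ (a <= (z.1 : R) + (z.2 : R) * v <= b)%R].

Lemma measurable_strip (E : set R) (v a b : R) :
  measurable E -> measurable (strip E v a b).
Proof.
move=> mE.
have -> : strip E v a b =
    (snd @^-1` E) `&` ((fun z => (z.1 : R) + (z.2 : R) * v) @^-1` `[a, b]).
  by apply/seteqP; split => -[x y] /=; rewrite in_itv.
apply: measurableI.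
  rewrite -[X in measurable X]setTI; exact: measurable_snd.
rewrite -[X in measurable X]setTI.
have mf : measurable_fun setT (fun z : RR => (z.1 : R) + (z.2 : R) * v).
  apply: measurable_funD; first exact: measurable_fst.
  apply: measurable_funM; first exact: measurable_snd.
  exact: measurable_cst.
by apply: mf => //; exact: measurable_itv.
Qed.

Local Open Scope ereal_scope.

Lemma measurable_strip_section (E : set R) (v a b c : R) : measurable E ->
  measurable (E `&` [set s | (a <= c + s * v <= b)%R]).
Proof.
move=> mE; apply: measurableI => //.
have -> : [set s | (a <= c + s * v <= b)%R] =
    ((fun s => (c + s * v)%R) @^-1` `[a, b]).
  by apply/seteqP; split => x /=; rewrite in_itv.
rewrite -[X in measurable X]setTI.
have mf : measurable_fun setT (fun s : R => (c + s * v)%R).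
  apply: measurable_funD; first exact: measurable_cst.
  apply: measurable_funM; first exact: measurable_id.
  exact: measurable_cst.
by apply: mf => //; exact: measurable_itv.
Qed.

Lemma measure_strip_sectionE (E : set R) (v a b c : R) : measurable E ->
  mu (E `&` [set s | (a <= c + s * v <= b)%R]) =
  \int[mu]_s (EFin \o \1_(strip E v a b)) (c, s).
Proof.
move=> mE; rewrite -[X in mu X]setIT -integral_indic//; last exact: measurable_strip_section.
Qed.

Lemma measurable_fun_strip_section (E : set R) (v a b : R) : measurable E ->
  measurable_fun setT (fun c : R => mu (E `&` [set s | (a <= c + s * v <= b)%R])).
Proof.
move=> mE; under eq_fun do rewrite measure_strip_sectionE//.
apply: (@measurable_fun_fubini_tonelli_F _ _ _ _ _ mu
  (EFin \o \1_(strip E v a b))) => //.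
  by apply/measurable_EFinP; apply: measurable_indic; exact: measurable_strip.
by move=> z; rewrite lee_fin.
Qed.

(** Tonelli: for fixed [s], the offsets [c] with [a <= c + s * v <= b] form an interval of length
    [b - a], even when [v = 0]. *)
Lemma integral_strip_section_le (E : set R) (v a b : R) : measurable E -> (a <= b)%R ->
  \int[mu]_c mu (E `&` [set s | (a <= c + s * v <= b)%R]) <= (b - a)%:E * mu E.
Proof.
move=> mE ab.
pose B := strip E v a b.
have mB : measurable B by exact: measurable_strip.
have mf : measurable_fun setT (EFin \o \1_B : RR -> \bar R).
  exact/measurable_EFinP/measurable_indic.
have f0 (z : RR) : 0 <= (EFin \o \1_B) z by rewrite lee_fin.
under eq_integral do rewrite measure_strip_sectionE//.
rewrite (fubini_tonelli (m1 := mu) (m2 := mu) (EFin \o \1_B))//.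
have m1E : measurable_fun setT (fun s => (\1_E s)%:E : \bar R).
  exact/measurable_EFinP/measurable_indic.
rewrite -[E in leRHS]setIT -integral_indic// -ge0_integralZl//; last by rewrite lee_fin subr_ge0.
apply: ge0_le_integral => //=.
- by move=> s _; apply: integral_ge0 => c _; rewrite lee_fin.
- exact: (@measurable_fun_fubini_tonelli_G _ _ _ _ _ mu (EFin \o \1_B)).
- exact: measurable_funeM.
move=> s _; have [sE|sE] := pselect (E s); last first.
  rewrite integral0_eq ?mule_ge0 ?lee_fin ?subr_ge0// => c _.
  by rewrite indicE memNset//= => -[].
have -> : \int[mu]_c (\1_B (c, s))%:E = \int[mu]_c (\1_(`[a - s * v, b - s * v]%classic) c)%:E.
  apply: eq_integral => c _; rewrite !indicE; congr (_%:R%:E).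
  congr nat_of_bool; apply/idP/idP; rewrite !inE /B/= in_itv/=.
    by move=> [_]; lra.
  by move=> ?; split => //; lra.
rewrite integral_indic//= setIT lebesgue_measure_itv/= lte_fin indicE mem_set// mule1.
case: ifPn => _; first by rewrite -EFinD lee_fin; lra.
by rewrite lee_fin subr_ge0.
Qed.

(** Averaging over the offset: if every [c] in [[y - rho, y + rho]] gave a sum above [C / rho],
    integrating over this interval of length [2 rho] would give at least [2 C], while Tonelli bounds
    the integral by [C]. *)
Lemma ex_translate_small_measure (E : nat -> set R) (w a b : nat -> R) (y v rho C : R) :
  (forall j, measurable (E j)) -> (forall j, 0 <= w j)%R ->
  (forall j, a j <= b j)%R -> (0 < rho)%R -> (0 < C)%R ->
  \sum_(0 <= j <oo) (w j * (b j - a j))%:E * mu (E j) <= C%:E ->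
  exists2 c, (`|c - y| <= rho)%R &
    \sum_(0 <= j <oo) (w j)%:E * mu (E j `&` [set s | (a j <= c + s * v <= b j)%R])
    <= (C / rho)%:E.
Proof.
move=> mE w0 ab rho0 C0 H; apply: contrapT => /forall2NP Hc.
pose g j c := (w j)%:E * mu (E j `&` [set s | (a j <= c + s * v <= b j)%R]).
pose Q := `[(y - rho)%R, (y + rho)%R]%classic.
have mQ : measurable Q by exact: measurable_itv.
have g0 j c : 0 <= g j c by rewrite mule_ge0 ?lee_fin.
have mg j : measurable_fun setT (g j).
  by apply: measurable_funeM; exact: measurable_fun_strip_section.
have far (c : R) : (y - rho <= c <= y + rho)%R ->
    (C / rho)%:E <= \sum_(0 <= j <oo) g j c.
  move=> cQ; case: (Hc c) => [nc|/negP]; last by rewrite -ltNge => /ltW.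
  by exfalso; apply: nc; rewrite ler_distl.
have le1 : \int[mu]_(c in Q) (\sum_(0 <= j <oo) g j c) <= C%:E.
  rewrite integral_nneseries//; last by move=> j; apply: measurable_funTS; exact: mg.
  apply: le_trans H; apply: lee_nneseries => [j _ _|j _].
    exact: integral_ge0.
  apply: (@le_trans _ _ (\int[mu]_c g j c)).
    by apply: ge0_subset_integral => //; exact: (mg j).
  rewrite /g ge0_integralZl ?lee_fin//; last exact: measurable_fun_strip_section.
  rewrite EFinM -muleA lee_pmul ?lee_fin//; last exact: integral_strip_section_le.
  exact: integral_ge0.
have le2 : \int[mu]_(c in Q) (C / rho)%:E <= \int[mu]_(c in Q) (\sum_(0 <= j <oo) g j c).
  apply: ge0_le_integral => //.
    by move=> *; rewrite lee_fin ltW ?divr_gt0.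
  apply: (@measurable_funTS _ _ _ _ _ (fun c => \sum_(0 <= j <oo) g j c)).
    by apply: ge0_emeasurable_sum.
have := le_trans le2 le1; rewrite integral_cst//= /Q lebesgue_measure_itv/= lte_fin.
rewrite ifT; last lra.
rewrite -EFinD -EFinM lee_fin.
have -> : (C / rho * (y + rho - (y - rho)) = C * 2)%R by field; rewrite gt_eqF.
lra.
Qed.

End strips.

Lemma rV_norm_le (R : realType) n (x : 'rV[R]_n) (e : R) :
  0 <= e -> (forall i, `|x ord0 i| <= e) -> `|x| <= e.
Proof.
move=> e0 H; rewrite /Num.norm/= mx_normrE; apply/bigmax_leP; split => // -[i j] _ /=.
by rewrite ord1.
Qed.

Lemma rV_coord_le (R : realType) n (x : 'rV[R]_n) (i : 'I_n) : `|x ord0 i| <= `|x|.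
Proof.
rewrite [leRHS]/Num.norm/= mx_normrE; apply/bigmax_geP; right; exists (ord0, i) => //.
Qed.

Section null.
Variable R : realType.
Local Notation mu := (@lebesgue_measure R).

(** The coordinates of the base point are chosen one at a time by averaging, each choice serving all
    boxes at once. A choice trades one side length of every box for a factor [1 / rho], and [E j]
    shrinks to the parameters at which the line meets box [j] in the coordinates chosen so far. *)
Lemma ex_point_small_measure (I : eqType) (r : seq I) (E : nat -> set R)
    (a b : nat -> I -> R) (y v : I -> R) (rho C : R) :
  uniq r -> (forall j, measurable (E j)) -> (forall j i, a j i <= b j i) ->
  0 < rho -> 0 < C ->
  (\sum_(0 <= j <oo) (\prod_(i <- r) (b j i - a j i))%:E * mu (E j) <= C%:E)%E ->
  exists (c : I -> R) (E' : nat -> set R),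
  [/\ forall i, `|c i - y i| <= rho, forall j, measurable (E' j),
      (forall j s, E j s ->
        (forall i, i \in r -> a j i <= c i + s * v i <= b j i) -> E' j s) &
      (\sum_(0 <= j <oo) mu (E' j) <= (C / rho ^+ size r)%:E)%E].
Proof.
elim: r E C => [|i r IH] E C /= => [_|/andP[ir ur]] mE ab rho0 C0.
  under eq_eseriesr do rewrite big_nil mul1e.
  move=> H; exists y, E; split => //; last by rewrite expr0 divr1.
  by move=> i; rewrite subrr normr0 ltW.
under eq_eseriesr do rewrite big_cons mulrC.
have w0 j : 0 <= \prod_(k <- r) (b j k - a j k).
  by rewrite prodr_ge0// => k _; rewrite subr_ge0.
move=> /(ex_translate_small_measure (y i) (v i) mE w0 (fun j => ab j i) rho0 C0)[c0 c0y H].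
have [||c' [E' [c'y mE' HE' sE']]] := IH _ (C / rho) ur _ ab rho0 _ H.
- by move=> j; exact: measurable_strip_section.
- by rewrite divr_gt0.
exists (fun k => if k == i then c0 else c' k), E'; split => //.
- by move=> k; case: ifPn => [/eqP->|_].
- move=> j s Es Hs; apply: HE'.
    split => //=; have := Hs i; rewrite mem_head eqxx; exact.
  move=> k kr; have := Hs k; rewrite inE kr orbT ifN; first exact.
  by apply: contraNneq ir => <-.
- apply: (le_trans sE'); rewrite lee_fin exprS invfM mulrA//.
Qed.

(** The coordinate choice is applied to boxes covering [A], with parameters in [[0, h]]. [D] is the
    union of the surviving parameter sets, hence measurable whatever [A] is. *)
Lemma null_set_line d (A : set 'rV[R]_d) (y v : 'rV[R]_d) (h rho eps : R) :
  Defs.null_set A -> 0 < h -> 0 < rho -> 0 < eps ->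
  exists2 c : 'rV[R]_d, `|c - y| <= rho &
  exists D : set R, [/\ measurable D, (mu D <= eps%:E)%E &
    forall s, 0 <= s <= h -> A (c + s *: v) -> D s].
Proof.
move=> A0 h0 rho0 eps0.
(* The volume budget of the cover: multiplied by the length [h] and divided by [rho] once per
   coordinate, it leaves exactly [eps]. *)
have e0 : 0 < eps * rho ^+ d / h by rewrite divr_gt0// mulr_gt0// exprn_gt0.
have [P [a [b [ab Acov sab]]]] := A0 _ e0.
pose E j : set R := if P j then `[0, h]%classic else set0.
have mE j : measurable (E j) by rewrite /E; case: ifP.
have Crho : 0 < eps * rho ^+ d by rewrite mulr_gt0// exprn_gt0.
have prod0 j : 0 <= \prod_(i < d) (b j ord0 i - a j ord0 i).
  by rewrite prodr_ge0// => k _; rewrite subr_ge0.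
have [|c [E' [cy mE' HE' sE']]] :=
  @ex_point_small_measure _ (enum 'I_d) E (fun j => a j ord0) (fun j => b j ord0)
    (y ord0) (v ord0) rho (eps * rho ^+ d) (enum_uniq _) mE ab rho0 Crho.
  have -> : (eps * rho ^+ d)%:E = (h%:E * (eps * rho ^+ d / h)%:E)%E.
    by rewrite -EFinM; congr EFin; field; rewrite gt_eqF.
  apply: (@le_trans _ _ _ _ _ _ (lee_wpmul2l (ltW (h0 : 0%:E < h%:E)%E) sab)).
  rewrite -nneseriesZl//; last by move=> j _; rewrite lee_fin.
  rewrite [leRHS]eseries_mkcond; apply: lee_nneseries => [j _ _|j _].
    by rewrite mule_ge0// lee_fin big_enum.
  rewrite big_enum /E; case: ifP => _; last by rewrite measure0 mule0.
  by rewrite lebesgue_measure_itv/= lte_fin h0 muleC -EFinD subr0.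
exists (\row_i c i).
  by apply: rV_norm_le => [|i]; [exact: ltW|rewrite !mxE].
exists (\bigcup_j E' j); split.
- exact: bigcupT_measurable.
- apply: (@le_trans _ _ (\sum_(0 <= j <oo) mu (E' j))%E).
    by apply: generalized_Boole_inequality => //; exact: bigcupT_measurable.
  apply: (le_trans sE'); rewrite lee_fin size_enum_ord mulfK// expf_neq0//.
  by rewrite gt_eqF.
- move=> s sh /Acov[j /= Pj Hj]; exists j => //; apply: HE'.
    by rewrite /E Pj/= in_itv.
  by move=> i _; have := Hj i; rewrite !mxE.
Qed.
End null.

(** * Slopes outside a null set *)

Section line.
Variable R : realType.
Local Notation mu := (@lebesgue_measure R).

Lemma measure_itv0_split (O : set R) (s t : R) : measurable O -> 0 <= s <= t ->
  fine (mu (O `&` `[0, t])) =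
  fine (mu (O `&` `[0, s])) + fine (mu (O `&` `]s, t])).
Proof.
move=> mO /andP[s0 st].
have fin (i : interval R) (x y : R) : [set` i] `<=` `[x, y]%classic ->
    mu (O `&` [set` i]) \is a fin_num.
  move=> H; rewrite ge0_fin_numE//; apply: (@le_lt_trans _ _ (mu `[x, y]%classic)).
    apply: le_measure; rewrite ?inE//; last by move=> z [_ /H].
    by apply: measurableI => //; exact: measurable_itv.
  by rewrite lebesgue_measure_itv/=; case: ifP => _; rewrite -?EFinD ltry.
rewrite -fineD; last 2 first.
  exact: (fin _ 0 s).
  by apply: (fin _ s t); exact: subset_itv_oc_cc.
rewrite -measureU//; last 3 first.
  by apply: measurableI => //; exact: measurable_itv.
  by apply: measurableI => //; exact: measurable_itv.
  apply/seteqP; split => // x [[_]] /=; rewrite !in_itv/= => /andP[_ xs].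
  by move=> [_ /andP[sx _]]; have := le_lt_trans xs sx; rewrite ltxx.
rewrite -setIUr; congr (fine (mu (O `&` _))).
apply/seteqP; split => x /=; rewrite !in_itv/=.
  move=> /andP[x0 xt]; have [xs|xs] := leP x s; first by left; rewrite x0.
  by right; rewrite xt.
by move=> [/andP[-> xs]|/andP[xs ->]]/=; lra.
Qed.

Lemma fine_measure_itv_le (O : set R) (s t : R) : measurable O -> s <= t ->
  0 <= fine (mu (O `&` `]s, t])) <= t - s.
Proof.
move=> mO st; rewrite fine_ge0//=.
have mst : mu `]s, t]%classic = (t - s)%:E.
  rewrite lebesgue_measure_itv/= lte_fin; case: ltP => [|ts]; first by rewrite EFinD.
  by congr EFin; lra.
have le : (mu (O `&` `]s, t]) <= (t - s)%:E)%E.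
  rewrite -mst; apply: le_measure; rewrite ?inE//.
  by apply: measurableI => //; exact: measurable_itv.
rewrite -lee_fin fineK// ge0_fin_numE//; exact: (le_lt_trans le (ltry _)).
Qed.

Lemma fine_measure_itv_sub (O : set R) (s t : R) : s <= t ->
  `]s, t]%classic `<=` O -> fine (mu (O `&` `]s, t])) = t - s.
Proof.
move=> st sO; rewrite setIidr// lebesgue_measure_itv/= lte_fin.
case: ltP => [_|ts]; first by rewrite -EFinD.
by apply/eqP; rewrite eq_le subr_ge0 st subr_le0.
Qed.

(** A penalty proportional to the measure of [O] in [[0, t]] is subtracted, [O] being an open set
    around [D] of almost the same measure. Inside [O] the penalty outweighs the Lipschitz growth of
    [phi]; outside, the slope hypothesis applies. The total penalty gives the error term. *)
Lemma slope_le_off_small_set (phi : R -> R) (h c M eps : R) (D : set R) :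
  0 <= h -> 0 <= M ->
  (forall s t, 0 <= s <= h -> 0 <= t <= h -> `|phi t - phi s| <= M * `|t - s|) ->
  measurable D -> (mu D <= eps%:E)%E ->
  (forall t e, 0 <= t < h -> ~ D t -> 0 < e ->
     \forall k \near 0^'+, phi (t + k) <= phi t + k * (c + e)) ->
  phi h <= phi 0 + h * c + (M + `|c|) * eps.
Proof.
move=> h0 M0 lip mD muD slope.
have M' : 0 < M + `|c| + 1 by rewrite ltr_wpDl// addr_ge0.
apply/ler_addgt0Pr => e0 e0_gt0.
pose e1 := e0 / (M + `|c| + 1).
have e1_gt0 : 0 < e1 by rewrite divr_gt0.
(* Openness matters: each point of [O] starts an interval inside [O], along which the penalty grows
   at full rate. *)
have [|O [oO DO muO]] := @lebesgue_regularity_outer _ D e1 mD _ e1_gt0.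
  exact: (le_lt_trans muD (ltry _)).
have mO : measurable O by exact: open_measurable.
pose m t := fine (mu (O `&` `[0, t])).
have mD' s t : 0 <= s -> s <= t -> m t = m s + fine (mu (O `&` `]s, t])).
  by move=> s0 st; apply: measure_itv0_split => //; rewrite s0.
pose psi t := phi t - c * t - (M + `|c|) * m t.
have mlip s t : 0 <= s -> 0 <= t -> `|m t - m s| <= `|t - s|.
  wlog st : s t / s <= t => [H s0 t0|s0 t0].
    have [st|/ltW ts] := leP s t; first exact: H.
    by rewrite distrC [leRHS]distrC; exact: H.
  rewrite (mD' s t)//; have /andP[] := fine_measure_itv_le mO st.
  by move=> ? ?; rewrite addrC addKr !ger0_norm// subr_ge0.
have lpsi : psi h <= psi 0.
  apply: dini_nonincreasing => //.
    apply/(@within_continuousP _ R^o) => t; rewrite /= in_itv/= => t0h.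
    apply/cvgrPdist_le => e e_gt0.
    pose K := M + `|c| + (M + `|c|) + 1.
    have K0 : 0 < K by rewrite ltr_wpDl// !addr_ge0.
    rewrite near_withinE; near=> s; rewrite /= in_itv/= => s0h.
    have : `|t - s| <= e / K.
      by near: s; apply: (@cvgr_dist_le _ R^o _ _ _ id t) => //; rewrite divr_gt0.
    rewrite ler_pdivlMr// => /(le_trans _); apply.
    have := lip _ _ s0h t0h; have := mlip s t.
    move=> /(_ (proj1 (andP s0h)) (proj1 (andP t0h))).
    move=> m1 p1; rewrite /psi.
    have -> : phi t - c * t - (M + `|c|) * m t - (phi s - c * s - (M + `|c|) * m s) =
      (phi t - phi s) - c * (t - s) - (M + `|c|) * (m t - m s) by ring.
    apply: le_trans (ler_normB _ _) _; apply: le_trans (lerD (ler_normB _ _) (lexx _)) _.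
    rewrite !normrM (ger0_norm (_ : 0 <= M + `|c|)) ?addr_ge0//.
    have : (M + `|c|) * `|m t - m s| <= (M + `|c|) * `|t - s|.
      by rewrite ler_wpM2l// addr_ge0.
    have := normr_ge0 (t - s); rewrite /K; lra.
  move=> t e /andP[t0 th] e_gt0.
  have [tO|tO] := pselect (O t).
    have /nbhs_ballP[r /= r0 rO] : nbhs t O by apply: open_nbhs_nbhs; split.
    pose k := Num.min (r / 2) (h - t).
    have k0 : 0 < k by rewrite /k lt_min divr_gt0// subr_gt0.
    have kr : k < r by rewrite /k gt_min ltr_pdivrMr//; apply/orP; left; lra.
    have kh : k <= h - t by rewrite /k ge_min lexx orbT.
    exists (t + k); first lra.
    have tk : t <= t + k by lra.
    rewrite /psi (mD' t (t + k))// fine_measure_itv_sub//; last first.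
      move=> x /=; rewrite in_itv/= => /andP[tx xt]; apply: rO.
      by rewrite /ball/= ltr0_norm; lra.
    have /ler_normlW := lip t (t + k) ltac:(lra) ltac:(lra).
    have -> : t + k - t = k by ring.
    rewrite (gtr0_norm k0) => L1.
    have : 0 <= k * e by rewrite mulr_ge0// ltW.
    have : `|c| * k + c * k >= 0.
      rewrite -mulrDl; apply: mulr_ge0; last exact: ltW.
      by have := ler_norm (- c); rewrite normrN; lra.
    lra.
  have nDt : ~ D t by move=> /DO.
  near (0 : R)^'+ => k.
  have k0 : 0 < k by near: k; exact: nbhs_right_gt.
  have kh : k < h - t by near: k; apply: nbhs_right_lt; rewrite subr_gt0.
  exists (t + k); first lra.
  have : phi (t + k) <= phi t + k * (c + e).
    by near: k; apply: slope => //; rewrite t0.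
  have tk : t <= t + k by lra.
  rewrite /psi (mD' t (t + k))//; have /andP[] := fine_measure_itv_le mO tk.
  set f := fine _ => f0 _.
  have : 0 <= (M + `|c|) * f by rewrite mulr_ge0// addr_ge0.
  lra.
have mh : m h <= eps + e1.
  have muO' : (mu O <= (eps + e1)%:E)%E.
    have -> : O = D `|` (O `\` D) by rewrite setDUK.
    apply: le_trans (measureU2 _ _ _) _ => //; first exact: measurableD.
    by rewrite EFinD leeD// ltW.
  have le : (mu (O `&` `[0%R, h]%classic) <= (eps + e1)%:E)%E.
    apply: le_trans muO'; apply: le_measure; rewrite ?inE//.
    by apply: measurableI => //; exact: measurable_itv.
  rewrite /m -lee_fin fineK// ge0_fin_numE//; exact: (le_lt_trans le (ltry _)).
have m0 : 0 <= m 0 by rewrite fine_ge0.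
have : (M + `|c|) * m h <= (M + `|c|) * (eps + e1).
  by rewrite ler_wpM2l// addr_ge0.
have : 0 <= (M + `|c|) * m 0 by rewrite mulr_ge0// addr_ge0.
have : (M + `|c|) * e1 <= e0.
  rewrite /e1 mulrA ler_pdivrMr// mulrC ler_pM2l//; lra.
move: lpsi; rewrite /psi; lra.
Unshelve. all: by end_near. Qed.

End line.

Definition lipschitz_near (R : realType) (U W : normedModType R) (F : U -> W) (y : U) :=
  exists K r : R, [/\ 0 <= K, 0 < r &
    forall z z', `|z - y| < r -> `|z' - y| < r -> `|F z - F z'| <= K * `|z - z'|].

(* The slope inequality is integrated along a parallel of the segment from [y] to
   [y + h G y] that meets [A] in small length. *)
Lemma directional_slope_ae (R : realType) d (Phi : 'rV[R]_d -> R^o)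
    (G : 'rV[R]_d -> 'rV[R]_d) (psi : 'rV[R]_d -> R) (A : set 'rV[R]_d) :
  Defs.null_set A -> (forall y, lipschitz_near Phi y) ->
  continuous G -> continuous psi ->
  (forall y e, ~ A y -> 0 < e ->
     \forall h \near 0^'+, Phi (y + h *: G y) <= Phi y + h * (psi y + e)) ->
  forall y e, 0 < e ->
     \forall h \near 0^'+, Phi (y + h *: G y) <= Phi y + h * (psi y + e).
Proof.
move=> A0 lip cG cpsi slope y e e_gt0.
have [K [r [K0 r0 Hlip]]] := lip y.
set v := G y.
(* Continuity of [psi] costs [e1] and replacing the direction [G z] by [v] costs [K * e1]; together
   they stay below [e = (K + 2) * e1]. *)
pose e1 := e / (K + 2).
have K2 : 0 < K + 2 by lra.
have e1_gt0 : 0 < e1 by rewrite divr_gt0.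
have [r' [r'0 r'r HG Hpsi]] : exists r', [/\ 0 < r', r' <= r,
    forall z, `|z - y| < r' -> `|G z - v| <= e1 &
    forall z, `|z - y| < r' -> `|psi z - psi y| <= e1].
  have /cvgrPdist_le /(_ _ e1_gt0) /nbhs_ballP [r1 /= r10 H1] := cG y.
  have /cvgrPdist_le /(_ _ e1_gt0) /nbhs_ballP [r2 /= r20 H2] := cpsi y.
  exists (Num.min r (Num.min r1 r2)); split.
  - by rewrite !lt_min r0 r10.
  - by rewrite ge_min lexx.
  - move=> z; rewrite !lt_min => /and3P[_ zr1 _]; rewrite distrC; apply: H1.
    by rewrite -ball_normE/= distrC.
  - move=> z; rewrite !lt_min => /and3P[_ _ zr2]; rewrite distrC; apply: H2.
    by rewrite -ball_normE/= distrC.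
near=> h.
have h0 : 0 < h by near: h; exact: nbhs_right_gt.
have v1 : 0 < `|v| + 1 by rewrite ltr_wpDl.
have hv : h * `|v| < r' / 2.
  have : h < r' / 2 / (`|v| + 1).
    by near: h; apply: nbhs_right_lt; rewrite !divr_gt0.
  rewrite ltr_pdivlMr//; lra.
apply/ler_addgt0Pr => e0 e0_gt0.
(* [M] is the Lipschitz constant of [Phi] along lines of direction [v] near [y], and [c] the slope
   bound off the exceptional parameters. *)
pose M := K * `|v|; pose c := psi y + e1 + K * e1.
have M0 : 0 <= M by rewrite mulr_ge0.
have Mc : 0 < M + `|c| + 1 by rewrite ltr_wpDl// addr_ge0.
(* With [h] already fixed, the slack [e0] is split: half for the parameters in [D], and a quarter at
   each endpoint for the shift from [y] to [y']. *)
pose eps := e0 / 2 / (M + `|c| + 1).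
have eps0 : 0 < eps by rewrite !divr_gt0.
pose rho := Num.min (r' / 2) (e0 / 4 / (K + 2)).
have rho0 : 0 < rho by rewrite lt_min !divr_gt0.
have rho1 : rho <= r' / 2 by rewrite ge_min lexx.
have rho2 : K * rho <= e0 / 4.
  have : rho <= e0 / 4 / (K + 2) by rewrite ge_min lexx orbT.
  rewrite ler_pdivlMr//; lra.
have [y' y'y [D [mD muD HD]]] := null_set_line y v A0 h0 rho0 eps0.
have near_y s : 0 <= s <= h -> `|y' + s *: v - y| < r'.
  move=> /andP[s0 sh]; rewrite addrAC.
  apply: le_lt_trans (ler_normD _ _) _; rewrite normrZ ger0_norm//.
  have : s * `|v| <= h * `|v| by rewrite ler_wpM2r.
  lra.
have near_y0 s : 0 <= s <= h -> `|y + s *: v - y| < r'.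
  move=> /andP[s0 sh]; rewrite addrAC subrr add0r normrZ ger0_norm//.
  have : s * `|v| <= h * `|v| by rewrite ler_wpM2r.
  lra.
have h0h : 0 <= h <= h by rewrite lexx ltW.
have h00 : 0 <= (0 : R) <= h by rewrite lexx ltW.
have Hline : Phi (y' + h *: v) <= Phi (y' + 0 *: v) + h * c + (M + `|c|) * eps.
  apply: (@slope_le_off_small_set _ (fun s => Phi (y' + s *: v)) h c M eps D (ltW h0) M0) => //.
    move=> s t s0h t0h; apply: le_trans (Hlip _ _ _ _) _.
    - exact: lt_le_trans (near_y _ t0h) r'r.
    - exact: lt_le_trans (near_y _ s0h) r'r.
    - rewrite opprD addrACA subrr add0r -scalerBl normrZ mulrA /M.
      by rewrite [leRHS]mulrAC.
  move=> t e2 /andP[t0 th] Dt e2_gt0.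
  have t0h : 0 <= t <= h by rewrite t0 ltW.
  set z := y' + t *: v.
  have zy : `|z - y| < r' by exact: near_y.
  have zA : ~ A z by move=> /HD; apply: contra_not Dt; exact.
  have sl := slope z e2 zA e2_gt0.
  near=> k.
  have k0 : 0 < k by near: k; exact: nbhs_right_gt.
  (* The slope is known along [G z] but the segment runs along [v]. For [k] this small both
     [z + k *: v] and [z + k *: G z] stay in the Lipschitz ball, so the two values of [Phi] can be
     compared. *)
  have ngv : 0 < `|G z| + `|v| + 1 by rewrite ltr_wpDl// addr_ge0.
  have : k < (r' - `|z - y|) / (`|G z| + `|v| + 1).
    by near: k; apply: nbhs_right_lt; rewrite divr_gt0// subr_gt0.
  rewrite ltr_pdivlMr// => kk.
  have kG : 0 <= k * `|G z| by rewrite mulr_ge0// ltW.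
  have kv : 0 <= k * `|v| by rewrite mulr_ge0// ltW.
  have b1 : `|z + k *: v - y| < r.
    apply: lt_le_trans r'r; rewrite addrAC; apply: le_lt_trans (ler_normD _ _) _.
    rewrite normrZ gtr0_norm//; lra.
  have b2 : `|z + k *: G z - y| < r.
    apply: lt_le_trans r'r; rewrite addrAC; apply: le_lt_trans (ler_normD _ _) _.
    rewrite normrZ gtr0_norm//; lra.
  have L1 : Phi (z + k *: G z) <= Phi z + k * (psi z + e2) by near: k.
  have := Hlip _ _ b1 b2.
  rewrite opprD addrACA subrr add0r -scalerBr normrZ gtr0_norm// distrC.
  rewrite [`|v - _|]distrC => L2.
  have {L2} L2 : Phi (z + k *: v) <= Phi (z + k *: G z) + K * (k * `|G z - v|).
    by move: L2; rewrite ler_distl => /andP[]; lra.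
  have L3 : K * (k * `|G z - v|) <= K * (k * e1).
    by rewrite ler_wpM2l// ler_pM2l// HG.
  have L4 : k * psi z <= k * (psi y + e1).
    by rewrite ler_pM2l//; have := Hpsi _ zy; rewrite ler_distl => /andP[].
  rewrite [y' + (t + k) *: v](_ : _ = z + k *: v); last by rewrite scalerDl addrA.
  rewrite /c; lra.
have yy : `|y' - y| < r by rewrite (le_lt_trans y'y)//; lra.
have L1 : Phi y' <= Phi y + K * rho.
  have := Hlip y' y yy; rewrite subrr normr0 => /(_ r0).
  rewrite ler_distl => /andP[_ /le_trans]; apply.
  by rewrite lerD2l ler_wpM2l.
have L2 : Phi (y + h *: v) <= Phi (y' + h *: v) + K * rho.
  have := Hlip _ _ (lt_le_trans (near_y0 _ h0h) r'r) (lt_le_trans (near_y _ h0h) r'r).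
  rewrite opprD addrACA subrr addr0 distrC.
  rewrite ler_distl => /andP[+ _]; have : K * `|y - y'| <= K * rho.
    by rewrite ler_wpM2l// distrC.
  lra.
have L3 : (M + `|c|) * eps <= e0 / 2.
  rewrite /eps mulrA ler_pdivrMr// mulrC ler_pM2l ?divr_gt0//; lra.
have L4 : h * c <= h * (psi y + e).
  rewrite ler_pM2l// /c -addrA lerD2l.
  have -> : e = e1 * (K + 2) by rewrite /e1 mulfVK// gt_eqF.
  lra.
move: Hline; rewrite scale0r addr0; lra.
Unshelve. all: by end_near. Qed.

(** * Decay along trajectories *)

Lemma lipschitz_near_continuous (R : realType) (U W : normedModType R) (F : U -> W) :
  (forall y, lipschitz_near F y) -> continuous F.
Proof.
move=> lip y; have [K [r [K0 r0 H]]] := lip y; apply/cvgrPdist_le => e e0.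
have K1 : 0 < K + 1 by lra.
near=> z.
have zy : `|y - z| <= e / (K + 1).
  by near: z; apply: (@cvgr_dist_le _ U _ _ _ id y) => //; rewrite divr_gt0.
have zr : `|y - z| < r.
  by near: z; apply: (@cvgr_dist_lt _ U _ _ _ id y).
have yr : `|y - y| < r by rewrite subrr normr0.
have zr' : `|z - y| < r by rewrite distrC.
apply: (le_trans (H _ _ yr zr')).
by move: zy; rewrite ler_pdivlMr// => zy; have := normr_ge0 (y - z); lra.
Unshelve. all: by end_near. Qed.

(** The differential equation through right derivatives on [[0, T)]. This form follows from the
    integral equation, passes to pairs in a product space and suffices for the Dini comparison. *)
Definition right_flow (R : realType) (U : normedModType R) (F : U -> U) (T : R)
    (x : R -> U) : Prop :=
  {within `[0, T], continuous x} /\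
  forall t e, 0 <= t < T -> 0 < e ->
    \forall h \near 0^'+, `|x (t + h) - x t - h *: F (x t)| <= h * e.

(** Since [W] is locally Lipschitz, the [h * e1] discrepancy between [x (t + h)] and the Euler step
    changes [W] by at most [h * e / 2]. The slope of [W] along the field is thus a slope along the
    curve, and the exponential comparison applies. *)
Lemma right_flow_decay (R : realType) (U : normedModType R) (W : U -> R^o)
    (F : U -> U) (k rho T : R) (x : R -> U) :
  0 <= T -> 0 <= rho -> (forall y, lipschitz_near W y) ->
  (forall y e, 0 < e ->
     \forall h \near 0^'+, W (y + h *: F y) <= W y + h * (- k * W y + rho + e)) ->
  right_flow F T x ->
  W (x T) <= expR (- k * T) * W (x 0) + rho * (T * expR (`|k| * T) ^+ 2).
Proof.
move=> T0 rho0 lip slope [cx dx].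
apply: (@exp_comparison _ (W \o x)) => //.
  apply/(@within_continuousP _ R^o) => t tT.
  apply: (@cvg_comp _ _ _ x W _ (nbhs (x t))).
    by move/(@within_continuousP _ U): cx; apply.
  exact: (lipschitz_near_continuous lip).
move=> t e tT e0.
have [K [r [K0 r0 H]]] := lip (x t).
have K1 : 0 < K + 1 by lra.
pose e1 := e / 2 / (K + 1).
have e1_gt0 : 0 < e1 by rewrite !divr_gt0.
have e2_gt0 : 0 < e / 2 by rewrite divr_gt0.
have N0 : 0 < `|F (x t)| + e1 by rewrite ltr_wpDl.
near=> h.
have h0 : 0 < h by near: h; exact: nbhs_right_gt.
have hr : h * (`|F (x t)| + e1) < r.
  rewrite -ltr_pdivlMr//; near: h; apply: nbhs_right_lt; rewrite divr_gt0//.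
have he1 : 0 < h * e1 by rewrite mulr_gt0.
have Hx : `|x (t + h) - x t - h *: F (x t)| <= h * e1 by near: h; exact: dx.
have Hs : W (x t + h *: F (x t)) <= W (x t) + h * (- k * W (x t) + rho + e / 2).
  by near: h; exact: slope.
have b2 : `|x t + h *: F (x t) - x t| < r.
  rewrite addrAC subrr add0r normrZ gtr0_norm//; lra.
have b1 : `|x (t + h) - x t| < r.
  have -> : x (t + h) - x t = (x (t + h) - x t - h *: F (x t)) + h *: F (x t).
    by rewrite subrK.
  apply: le_lt_trans (ler_normD _ _) _; rewrite normrZ gtr0_norm//; lra.
have := H _ _ b1 b2; rewrite opprD addrA => L.
have L2 : W (x (t + h)) <= W (x t + h *: F (x t)) + K * (h * e1).
  move: L; rewrite ler_distl => /andP[_ /le_trans]; apply.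
  by rewrite lerD2l ler_wpM2l.
have L3 : K * (h * e1) <= h * (e / 2).
  have -> : e / 2 = (K + 1) * e1 by rewrite /e1; field; rewrite gt_eqF.
  lra.
rewrite /=; lra.
Unshelve. all: by end_near. Qed.

Lemma right_flow_pair (R : realType) (U : normedModType R) (F1 F2 : U -> U) (T : R)
    (x y : R -> U) :
  right_flow F1 T x -> right_flow F2 T y ->
  right_flow (fun z : U * U => (F1 z.1, F2 z.2)) T (fun t => (x t, y t)).
Proof.
move=> [cx dx] [cy dy]; split.
  apply/(@within_continuousP _ (U * U)%type) => t tT.
  move/(@within_continuousP _ U)/(_ t tT) in cx.
  move/(@within_continuousP _ U)/(_ t tT) in cy.
  exact: cvg_pair.
move=> t e tT e0; near=> h.
rewrite {1}/Num.norm/= ge_max; apply/andP; split.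
  by near: h; exact: dx.
by near: h; exact: dy.
Unshelve. all: by end_near. Qed.

(** By the chain rule the two partial differentials are the joint differential at [(v, 0)] and at
    [(0, w)]; linearity adds them into the derivative along [(v, w)]. *)
Lemma differentiable_right_slope_pair (R : realType) (U : normedModType R)
   (V : U -> U -> R) (x y v w : U) :
  differentiable (fun z : U * U => V z.1 z.2 : R^o) (x, y) ->
  forall e, 0 < e -> \forall h \near 0^'+,
   V (x + h *: v) (y + h *: w) <= V x y + h * ('d (fun z => V z y : R^o) x v
       + 'd (fun z => V x z : R^o) y w + e).
Proof.
move=> dV e e0; set W := (fun z : U * U => V z.1 z.2 : R^o).
have dX (z : U) : differentiable (id : U -> U) z by exact: ex_diff.
have dY (z u : U) : differentiable (fun=> u : U) z by exact: differentiable_cst.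
have Ex : 'd (fun z => V z y : R^o) x v = 'd W (x, y) (v, 0).
  by rewrite (_ : (fun z => _) = W \o (fun z => (z, y)))// diff_comp//= diff_pair//= !diff_val.
have Ey : 'd (fun z => V x z : R^o) y w = 'd W (x, y) (0, w).
  by rewrite (_ : (fun z => _) = W \o (fun z => (x, z)))// diff_comp//= diff_pair//= !diff_val.
rewrite Ex Ey -linearD/=.
have -> : (v, 0) + (0, w) = (v, w) :> U * U by congr pair; rewrite /= ?addr0 ?add0r.
have D : is_derive (x, y) (v, w) W ('d W (x, y) (v, w)).
  by split; [exact: diff_derivable|rewrite deriveE].
exact: (derivable_right_slope D e0).
Qed.

Lemma norm_row_mx_le (R : realType) n1 n2 (x : 'rV[R]_n1) (y : 'rV[R]_n2) e :
  `|x| <= e -> `|y| <= e -> `|row_mx x y| <= e.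
Proof.
move=> xe ye; apply: rV_norm_le; first exact: le_trans (normr_ge0 _) xe.
move=> i; rewrite mxE; case: splitP => j _.
  exact: le_trans (rV_coord_le _ _) xe.
exact: le_trans (rV_coord_le _ _) ye.
Qed.

Lemma norm_lsubmx_le (R : realType) n1 n2 (x : 'rV[R]_(n1 + n2)) : `|lsubmx x| <= `|x|.
Proof. by apply: rV_norm_le => // i; rewrite mxE; exact: rV_coord_le. Qed.

Lemma norm_rsubmx_le (R : realType) n1 n2 (x : 'rV[R]_(n1 + n2)) : `|rsubmx x| <= `|x|.
Proof. by apply: rV_norm_le => // i; rewrite mxE; exact: rV_coord_le. Qed.

Lemma pair_distE (R : realType) (U : normedModType R) (a b c d : U) :
  `|(a, b) - (c, d) : U * U| = Num.max `|a - c| `|b - d|.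
Proof. by []. Qed.

Lemma continuous_distP (R : realType) (U W : normedModType R) (F : U -> W) :
  continuous F <-> forall y e, 0 < e -> exists2 r, 0 < r &
    forall z, `|z - y| < r -> `|F z - F y| <= e.
Proof.
split=> [cF y e e0|H y].
  have /cvgrPdist_le /(_ _ e0) /nbhs_ballP[r /= r0 Hr] := cF y.
  by exists r => // z zr; rewrite distrC; apply: Hr; rewrite -ball_normE/= distrC.
apply/cvgrPdist_le => e e0; have [r r0 Hr] := H y e e0.
near=> z; rewrite distrC; apply: Hr; rewrite distrC.
by near: z; apply: (@cvgr_dist_lt _ U _ _ _ id y).
Unshelve. all: by end_near. Qed.

Lemma continuous_affine_comp (R : realType) (U : normedModType R) (f : U -> R^o) (a b : R) :
  continuous f -> continuous (fun z => a * f z + b).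
Proof.
move=> cf z; apply: cvgD; last exact: cvg_cst.
by apply: cvgMr; exact: cf.
Qed.

Lemma null_setS (R : realType) d (A B : set 'rV[R]_d) :
  A `<=` B -> Defs.null_set B -> Defs.null_set A.
Proof.
move=> AB B0 e /B0[P [a [b [ab cov s]]]]; exists P, a, b; split => //.
exact: subset_trans AB cov.
Qed.

(** Null sets live in spaces of row vectors, so pairs are encoded as concatenated rows of length
    [n + n]. Concatenation and splitting do not increase the infinity norm, which transfers the
    Lipschitz and continuity bounds. *)
Lemma pair_slope_ae (R : realType) n (V : 'rV[R]_n -> 'rV[R]_n -> R)
    (F1 F2 : 'rV[R]_n -> 'rV[R]_n) (k rho : R) :
  (forall z : 'rV[R]_n * 'rV[R]_n, lipschitz_near (fun z => V z.1 z.2 : R^o) z) ->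
  continuous F1 -> continuous F2 ->
  almost_every_pair (fun x y : 'rV[R]_n =>
     differentiable (fun z : 'rV[R]_n * 'rV[R]_n => V z.1 z.2 : R^o) (x, y) /\
     'd (fun z => V z y : R^o) x (F1 x) + 'd (fun z => V x z : R^o) y (F2 y)
     <= - k * V x y + rho) ->
  forall x y e, 0 < e -> \forall h \near 0^'+,
    V (x + h *: F1 x) (y + h *: F2 y) <= V x y + h * (- k * V x y + rho + e).
Proof.
move=> lipV cF1 cF2 A0 x y e e0.
pose Phi (z : 'rV[R]_(n + n)) : R^o := V (lsubmx z) (rsubmx z).
pose G (z : 'rV[R]_(n + n)) := row_mx (F1 (lsubmx z)) (F2 (rsubmx z)).
have lipPhi z : lipschitz_near Phi z.
  have [K [r [K0 r0 H]]] := lipV (lsubmx z, rsubmx z).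
  have small w : `|w - z| < r -> `|(lsubmx w, rsubmx w) - (lsubmx z, rsubmx z)| < r.
    move=> wr; rewrite pair_distE gt_max -!raddfB/=; apply/andP; split.
      exact: le_lt_trans (norm_lsubmx_le _) wr.
    exact: le_lt_trans (norm_rsubmx_le _) wr.
  exists K, r; split => // w w' /small Hw /small Hw'.
  apply: le_trans (H _ _ Hw Hw') _; rewrite ler_wpM2l//.
  by rewrite pair_distE ge_max -!raddfB/= norm_lsubmx_le norm_rsubmx_le.
have cPhi := lipschitz_near_continuous lipPhi.
have cG : continuous G.
  apply/continuous_distP => z r r0.
  have [r1 r10 H1] := (iffLR (continuous_distP F1) cF1) (lsubmx z) r r0.
  have [r2 r20 H2] := (iffLR (continuous_distP F2) cF2) (rsubmx z) r r0.
  exists (Num.min r1 r2) => [|w]; rewrite lt_min ?r10// => /andP[w1 w2].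
  rewrite /G opp_row_mx add_row_mx; apply: norm_row_mx_le.
    by apply: H1; rewrite -raddfB/=; exact: le_lt_trans (norm_lsubmx_le _) w1.
  by apply: H2; rewrite -raddfB/=; exact: le_lt_trans (norm_rsubmx_le _) w2.
have cpsi : continuous (fun z => - k * Phi z + rho) by exact: continuous_affine_comp.
pose Q (a b : 'rV[R]_n) :=
  differentiable (fun z : 'rV[R]_n * 'rV[R]_n => V z.1 z.2 : R^o) (a, b) /\
     'd (fun z => V z b : R^o) a (F1 a) + 'd (fun z => V a z : R^o) b (F2 b)
     <= - k * V a b + rho.
have slope (z : 'rV[R]_(n + n)) e' :
    ~ [set row_mx z.1 z.2 | z in [set z | ~ Q z.1 z.2]] z -> 0 < e' ->
   \forall h \near 0^'+, Phi (z + h *: G z) <= Phi z + h * (- k * Phi z + rho + e').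
  move=> nA e'0.
  have [dV le] : Q (lsubmx z) (rsubmx z).
    apply: contrapT => nQ; apply: nA; exists (lsubmx z, rsubmx z) => //=.
    exact: hsubmxK.
  have := differentiable_right_slope_pair (F1 (lsubmx z)) (F2 (rsubmx z)) dV e'0.
  apply: filter_app; near=> h => /le_trans; rewrite /Phi !raddfD/=.
  rewrite !linearZ/= /G row_mxKl row_mxKr; apply.
  rewrite lerD2l ler_pM2l; last by near: h; exact: nbhs_right_gt.
  by rewrite lerD2r.
have := directional_slope_ae A0 lipPhi cG cpsi slope (row_mx x y) e0.
apply: filter_app; near=> h.
by rewrite /Phi /G !raddfD/= !linearZ/= !row_mxKl !row_mxKr.
Unshelve. all: by end_near. Qed.

(** * Existence of trajectories *)

Section integral_curves.
Variable R : realType.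
Local Notation mu := (@lebesgue_measure R).

Lemma Rintegral_increment (g : R -> R) (s t c e : R) :
  mu.-integrable `[0, t] (EFin \o g) -> 0 <= s <= t ->
  (forall r, s < r <= t -> `|g r - c| <= e) ->
  `|\int[mu]_(r in `[0, t]) g r - \int[mu]_(r in `[0, s]) g r - (t - s) * c|
  <= (t - s) * e.
Proof.
move=> ig /andP[s0 st] H.
have E : `[0, t]%classic = `[0, s]%classic `|` `]s, t]%classic.
  apply/seteqP; split => x /=; rewrite !in_itv/=.
    move=> /andP[x0 xt]; have [xs|xs] := leP x s; first by left; rewrite x0.
    by right; rewrite xt.
  by move=> [/andP[-> xs]|/andP[xs ->]]/=; lra.
have ig2 : mu.-integrable `]s, t] (EFin \o g).
  apply: integrableS ig => //; rewrite E; exact: subsetUr.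
have muE : mu `]s, t]%classic = (t - s)%:E.
  rewrite lebesgue_measure_itv/= lte_fin; case: ltP => [|ts]; first by rewrite EFinD.
  by congr EFin; lra.
have icst (k : R) : mu.-integrable `]s, t] (EFin \o cst k).
  apply: measurable_bounded_integrable => //=; [by rewrite muE ltry|exact: bounded_cst].
rewrite E Rintegral_setU//; last 2 first.
  by rewrite -E.
  apply/disj_setPS => x [] /=; rewrite !in_itv/= => /andP[_ xs] /andP[sx _].
  by have := le_lt_trans xs sx; rewrite ltxx.
rewrite [X in `|X - _|]addrAC subrr add0r.
have -> : (t - s) * c = \int[mu]_(r in `]s, t]) c.
  by rewrite Rintegral_cst// mulrC -[t - s]/(fine (t - s)%:E) -muE.
rewrite -RintegralB//; last exact: (icst c).
apply: le_trans (le_normr_Rintegral _ _) _ => //.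
  exact: (integrableB _ ig2 (icst c)).
have -> : (t - s) * e = \int[mu]_(r in `]s, t]) e.
  by rewrite Rintegral_cst// mulrC -[t - s]/(fine (t - s)%:E) -muE.
apply: le_Rintegral => //.
  exact: (integrable_norm (integrableB _ ig2 (icst c))).
exact: (icst e).
Qed.

(** By continuity of [F] along the curve, the integrand stays within [e] of [F (x t)] on a short
    interval to the right of [t]. The interval is open at [T], as for a concrete flow with only a
    left limit there. *)
Lemma integral_curve_right_slope n (F : 'rV[R]_n -> 'rV[R]_n) (T : R) (x : R -> 'rV[R]_n)
    (x0 : 'rV[R]_n) :
  continuous F -> {within `[0, T[, continuous x} ->
  (forall t, 0 <= t < T -> forall i,
    mu.-integrable `[0, t] (EFin \o (fun s => F (x s) ord0 i)) /\
    x t ord0 i = x0 ord0 i + \int[mu]_(s in `[0, t]) F (x s) ord0 i) ->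
  forall t e, 0 <= t < T -> 0 < e ->
    \forall h \near 0^'+, `|x (t + h) - x t - h *: F (x t)| <= h * e.
Proof.
move=> cF cx Hx t e /andP[t0 tT] e0.
have tI : `[0, T[%classic t by rewrite /= in_itv/= t0.
have [r1 r10 H1] := (iffLR (continuous_distP F) cF) (x t) e e0.
move/(@within_continuousP _ _)/(_ t tI)/cvgrPdist_lt/(_ _ r10) in cx.
move: cx; rewrite near_withinE => /nbhs_ballP[d /= d0 Hd].
near=> h.
have h0 : 0 < h by near: h; exact: nbhs_right_gt.
have hT : h < T - t by near: h; apply: nbhs_right_lt; rewrite subr_gt0.
have hd : h < d by near: h; apply: nbhs_right_lt.
apply: rV_norm_le; first by rewrite mulr_ge0// ltW.
move=> i; rewrite !mxE.
have th : 0 <= t + h < T by apply/andP; split; lra.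
have [ig ->] := Hx _ th i.
have [|_ ->] := Hx t _ i; first by rewrite t0.
have tth : 0 <= t <= t + h by rewrite t0; lra.
have := Rintegral_increment (c := F (x t) ord0 i) (e := e) ig tth.
have -> : t + h - t = h by ring.
set I1 := Rintegral _ _ _; set I2 := Rintegral _ _ _ => H.
have -> : x0 ord0 i + I1 - (x0 ord0 i + I2) - h * F (x t) ord0 i =
  I1 - I2 - h * F (x t) ord0 i by ring.
apply: H => r /andP[tr rth].
have -> : F (x r) ord0 i - F (x t) ord0 i = (F (x r) - F (x t)) ord0 i by rewrite !mxE.
apply: le_trans (rV_coord_le _ _) _; apply: H1; rewrite distrC; apply: Hd.
  by rewrite /ball/= ltr0_norm; lra.
by rewrite in_itv/=; lra.
Unshelve. all: by end_near. Qed.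

End integral_curves.

(** * Picard iteration for bounded, globally Lipschitz fields *)

Lemma geometric_cvg (R : realType) (u : nat -> R) (b : R) : 0 <= b ->
  (forall k, `|u k.+1 - u k| <= b / 2 ^+ k) ->
  forall k, `|lim (u @ \oo) - u k| <= 2 * b / 2 ^+ k.
Proof.
move=> b0 H.
have step m k : `|u (k + m)%N - u k| <= 2 * b / 2 ^+ k.
  (* The claim is strengthened by the remaining geometric tail so that the induction on [m]
     closes. *)
  suff : `|u (k + m)%N - u k| <= 2 * b / 2 ^+ k - 2 * b / 2 ^+ (k + m).
    by move/le_trans; apply; rewrite gerBl divr_ge0 ?mulr_ge0 ?exprn_ge0.
  elim: m => [|m IH]; first by rewrite addn0 !subrr normr0.
  rewrite addnS.
  have -> : u (k + m).+1 - u k = (u (k + m).+1 - u (k + m)%N) + (u (k + m)%N - u k).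
    by rewrite addrA subrK.
  apply: le_trans (ler_normD _ _) _; have := H (k + m)%N.
  move: IH; rewrite exprS; set P := 2 ^+ (k + m).
  have P0 : P != 0 by rewrite expf_neq0.
  have -> : 2 * b / (2 * P) = b / P by field.
  have -> : 2 * b / P = 2 * (b / P) by field.
  lra.
have cu : cvgn u.
  apply/cauchy_cvgP/cauchy_exP => e e0.
  have [k Hk] : exists k, 2 * b / 2 ^+ k < e.
    have c0 : 0 < e / (2 * b + 1) by rewrite divr_gt0//; lra.
    have /cvgrPdist_lt/(_ _ c0) : (2^-1 : R) ^+ k @[k --> \oo] --> (0 : R).
      by apply: cvg_expr; rewrite ger0_norm; lra.
    move=> [N _ /(_ N (leqnn N))]; rewrite /= sub0r normrN ger0_norm ?exprn_ge0// => HN.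
    exists N; move: HN; rewrite ltr_pdivlMr; last lra.
    rewrite exprVn; set P := (2 ^+ N)^-1; have P0 : 0 < P by rewrite invr_gt0 exprn_gt0.
    lra.
  suff near_uk : \forall m \near \oo, ball (u k) e (u m) by exists (u k).
  near=> m; rewrite -ball_normE/= distrC; apply: le_lt_trans Hk.
  have km : (k <= m)%N by near: m; exact: nbhs_infty_ge.
  by rewrite -(subnKC km); exact: step.
move=> k.
apply/ler_addgt0Pr => e e0.
have /cvgrPdist_le/(_ _ e0) ul := cu.
near \oo => m.
have lm : `|lim (u @ \oo) - u m| <= e by near: m.
have kn : (k <= m)%N by near: m; exact: nbhs_infty_ge.
have := step (m - k)%N k; rewrite subnKC// => H1.
have -> : lim (u @ \oo) - u k = (lim (u @ \oo) - u m) + (u m - u k).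
  by rewrite addrA subrK.
by apply: le_trans (ler_normD _ _) _; lra.
Unshelve. all: by end_near. Qed.

Section picard.
Variables (R : realType) (n : nat) (F : 'rV[R]_n -> 'rV[R]_n) (x0 : 'rV[R]_n).
Variables (K B : R).
Hypotheses (K0 : 0 < K) (B0 : 0 < B).
Hypothesis lipF : forall y z, `|F y - F z| <= K * `|y - z|.
Hypothesis bndF : forall y, `|F y| <= B.
Local Notation mu := (@lebesgue_measure R).

Let cF : continuous F.
Proof.
apply/continuous_distP => y e e0; exists (e / K); first exact: divr_gt0.
move=> z; rewrite ltr_pdivlMr// mulrC => zy.
exact: le_trans (lipF _ _) (ltW zy).
Qed.

Let lip_continuous (x : R -> 'rV[R]_n) :
  (forall s t, `|x t - x s| <= B * `|t - s|) -> continuous x.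
Proof.
move=> H; apply/(@continuous_distP R R^o) => y e e0; exists (e / B); first exact: divr_gt0.
move=> z; rewrite ltr_pdivlMr// mulrC => zy.
exact: le_trans (H _ _) (ltW zy).
Qed.

Let continuous_coord (x : R -> 'rV[R]_n) i : continuous x ->
  continuous (fun s => F (x s) ord0 i : R^o).
Proof.
move=> cx; apply/(@continuous_distP R R^o R^o) => y e e0.
have [r1 r10 H1] := (iffLR (continuous_distP F) cF) (x y) e e0.
have r12 : 0 < r1 / 2 by rewrite divr_gt0.
have [r2 r20 H2] := (iffLR (@continuous_distP R R^o _ x) cx) y _ r12.
exists r2 => // z /H2 xz.
have -> : F (x z) ord0 i - F (x y) ord0 i = (F (x z) - F (x y)) ord0 i by rewrite !mxE.
by apply: le_trans (rV_coord_le _ _) _; apply: H1; apply: le_lt_trans xz _; lra.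
Qed.

Let integrable_coord (x : R -> 'rV[R]_n) i t : continuous x ->
  mu.-integrable `[0, t] (EFin \o (fun s => F (x s) ord0 i)).
Proof.
move=> cx; apply: continuous_compact_integrable; first exact: segment_compact.
by apply: continuous_subspaceT; exact: continuous_coord.
Qed.

(* [Num.max 0 t] freezes the iterates on negative times. *)
Let step (x : R -> 'rV[R]_n) (t : R) : 'rV[R]_n :=
  \row_i (x0 ord0 i + \int[mu]_(s in `[0, Num.max 0 t]) F (x s) ord0 i).

Let step_lip (x : R -> 'rV[R]_n) : continuous x ->
  forall s t, `|step x t - step x s| <= B * `|t - s|.
Proof.
move=> cx s t; wlog st : s t / s <= t => [H|].
  have [|/ltW] := leP s t; first exact: H.
  by move=> /H; rewrite distrC [`|s - t|]distrC.
apply: rV_norm_le; first by rewrite mulr_ge0// ltW.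
move=> i; rewrite !mxE.
have mst : 0 <= Num.max 0 s <= Num.max 0 t.
  by rewrite le_max lexx/= ge_max !le_max lexx st orbT.
have := Rintegral_increment (c := 0) (e := B) (integrable_coord i (Num.max 0 t) cx) mst.
rewrite mulr0 subr0 => H.
set I1 := Rintegral _ _ _ in H *; set I2 := Rintegral _ _ _ in H *.
have -> : x0 ord0 i + I1 - (x0 ord0 i + I2) = I1 - I2 by ring.
apply: le_trans (H _) _ => [r _|].
  by rewrite subr0; exact: le_trans (rV_coord_le _ _) (bndF _).
rewrite mulrC ler_pM2l// ger0_norm ?subr_ge0//.
have [s0|s0] := leP 0 s; last first.
  by rewrite subr0; have [t0|t0] := leP 0 t; lra.
have [t0|t0] := leP 0 t; lra.
Qed.

(* The weight [e^(2 K t)] makes the Picard operator contract by 1/2 on the whole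
   half-line, so no gluing of short-time solutions is needed. *)
Let step_contraction (x y : R -> 'rV[R]_n) (a : R) :
  continuous x -> continuous y -> 0 <= a ->
  (forall s, 0 <= s -> `|x s - y s| <= a * expR (2 * K * s)) ->
  forall t, 0 <= t -> `|step x t - step y t| <= a / 2 * expR (2 * K * t).
Proof.
move=> cx cy a0 H t t0.
have aE (s : R) : 0 <= a / 2 * expR (2 * K * s).
  by rewrite mulr_ge0 ?expR_ge0// divr_ge0.
apply: rV_norm_le => //.
move=> i; rewrite !mxE max_r//.
set I1 := Rintegral _ _ _; set I2 := Rintegral _ _ _.
have -> : x0 ord0 i + I1 - (x0 ord0 i + I2) = I1 - I2 by ring.
pose g s := F (x s) ord0 i - F (y s) ord0 i.
have gb s : 0 <= s -> `|g s| <= K * a * expR (2 * K * s).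
  move=> s0; have -> : g s = (F (x s) - F (y s)) ord0 i by rewrite !mxE.
  apply: le_trans (rV_coord_le _ _) _; apply: le_trans (lipF _ _) _.
  by rewrite -mulrA ler_pM2l// H.
rewrite -RintegralB//; last 2 first.
  exact: integrable_coord.
  exact: integrable_coord.
rewrite -/(g _).
have cE : continuous (fun s => K * a * expR (2 * K * s) : R^o).
  move=> s; apply: cvgMr; apply: (continuous_comp (f := fun s => 2 * K * s)).
    by apply: cvgMr; exact: cvg_id.
  exact: continuous_expR.
have iE : mu.-integrable `[0, t] (EFin \o (fun s => K * a * expR (2 * K * s))).
  apply: continuous_compact_integrable; first exact: segment_compact.
  exact: continuous_subspaceT.
have ig : mu.-integrable `[0, t] (EFin \o g).
  exact: (integrableB _ (integrable_coord i t cx) (integrable_coord i t cy)).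
apply: le_trans (le_normr_Rintegral _ ig) _ => //.
apply: le_trans (le_Rintegral _ (integrable_norm ig) iE _) _ => //.
  by move=> s; rewrite /= in_itv/= => /andP[s0 _]; exact: gb.
move: t0; rewrite le_eqVlt => /predU1P[<-|t0].
  by rewrite set_itv1 Rintegral_set1.
pose G s := a / 2 * expR (2 * K * s).
have dG s : is_derive (s : R) 1 G (K * a * expR (2 * K * s)).
  apply: is_derive_eq; rewrite /GRing.scale/=; by field.
have cG : continuous (G : R -> R^o).
  move=> s; apply/differentiable_continuous/derivable1_diffP.
  by case: (dG s).
rewrite /Rintegral (@continuous_FTC2 _ _ G)//=.
- by rewrite -/(G t) gerBl; exact: aE.
- exact: continuous_subspaceT.
- split.
  + by move=> s _; case: (dG s).
  + apply: cvg_at_right_filter; exact: cG.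
  + apply: cvg_at_left_filter; exact: cG.
- by move=> s _; rewrite derive1E; case: (dG s).
Qed.


Let xs k := iter k step (fun=> x0).

Let xs_lip k : forall s t, `|xs k t - xs k s| <= B * `|t - s|.
Proof.
elim: k => [s t|k IH]; first by rewrite subrr normr0 mulr_ge0// ltW.
by apply: step_lip; exact: lip_continuous.
Qed.

Let xs_max k t : xs k (Num.max 0 t) = xs k t.
Proof.
case: k => // k; apply/rowP => i; rewrite !mxE.
by rewrite [Num.max 0 (Num.max 0 t)]max_r// le_max lexx.
Qed.

Let xs_step : exists2 a, 0 <= a & forall k t, 0 <= t ->
  `|xs k.+1 t - xs k t| <= a / 2 ^+ k * expR (2 * K * t).
Proof.
(* The first increment is at most [B * t], that is [B / (2 * K)] times [2 * K * t], and
   [2 * K * t <= e^(2 K t)]. The contraction then halves the constant at every step. *)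
exists (B / (2 * K)); first by rewrite divr_ge0 ?ltW// mulr_gt0.
have : 0 <= B / (2 * K) by rewrite divr_ge0 ?ltW// mulr_gt0.
have BE t : B * t = B / (2 * K) * (2 * K * t) by field; rewrite gt_eqF.
move: (B / (2 * K)) BE => a0 BE a0_ge0; elim=> [t t0|k IH t t0].
  have x00 : xs 1 0 = x0.
    apply/rowP => i; rewrite !mxE maxxx set_itv1 Rintegral_set1 addr0//.
  have := xs_lip 1 0 t; rewrite x00 subr0 ger0_norm// => H.
  apply: (le_trans H); rewrite expr0 divr1 BE.
  rewrite ler_wpM2l//; apply: le_trans (expR_ge1Dx _); lra.
rewrite exprS invfM mulrA mulrAC.
rewrite -[X in _ <= X](_ : a0 / 2 ^+ k / 2 * expR (2 * K * t) = _); last by ring.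
apply: step_contraction => //.
- exact: (lip_continuous (xs_lip k.+1)).
- exact: (lip_continuous (xs_lip k)).
- by rewrite divr_ge0 ?exprn_ge0.
Qed.

(** The solution is the coordinatewise limit of the iterates. It inherits their Lipschitz constant
    [B], hence is continuous, so the contraction applies to it; [x t] and [step x t] are then both
    within a vanishing distance of the next iterate. *)
Theorem picard_lindelof : exists x : R -> 'rV[R]_n,
  continuous x /\ forall t, 0 <= t -> forall i,
    mu.-integrable `[0, t] (EFin \o (fun s => F (x s) ord0 i)) /\
    x t ord0 i = x0 ord0 i + \int[mu]_(s in `[0, t]) F (x s) ord0 i.
Proof.
have [a0 a0_ge0 xsa0] := xs_step.
pose x t : 'rV[R]_n := \row_i lim ((fun k => xs k t ord0 i) @ \oo).
have conv k t : 0 <= t -> `|xs k t - x t| <= 2 * a0 / 2 ^+ k * expR (2 * K * t).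
  move=> t0; have ex0 := expR_ge0 (2 * K * t).
  apply: rV_norm_le; first by rewrite mulr_ge0// divr_ge0 ?mulr_ge0 ?exprn_ge0.
  move=> i; rewrite !mxE distrC.
  have -> : 2 * a0 / 2 ^+ k * expR (2 * K * t) =
    2 * (a0 * expR (2 * K * t)) / 2 ^+ k by ring.
  apply: (@geometric_cvg _ (fun k => xs k t ord0 i)); first by rewrite mulr_ge0.
  move=> {}k; have -> : xs k.+1 t ord0 i - xs k t ord0 i = (xs k.+1 t - xs k t) ord0 i.
    by rewrite !mxE.
  apply: le_trans (rV_coord_le _ _) _; apply: le_trans (xsa0 k t t0) _.
  by rewrite mulrAC.
have small (C e : R) : 0 <= C -> 0 < e -> exists k, C / 2 ^+ k <= e.
  move=> C0 e0; have c0 : 0 < e / (C + 1) by rewrite divr_gt0//; lra.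
  have /cvgrPdist_lt/(_ _ c0) : (2^-1 : R) ^+ k @[k --> \oo] --> (0 : R).
    by apply: cvg_expr; rewrite ger0_norm; lra.
  move=> [N _ /(_ N (leqnn N))]; rewrite /= sub0r normrN ger0_norm ?exprn_ge0// => HN.
  exists N; move: HN; rewrite ltr_pdivlMr; last lra.
  rewrite exprVn; set P := (2 ^+ N)^-1; have P0 : 0 < P by rewrite invr_gt0 exprn_gt0.
  lra.
have close (t e : R) : 0 <= t -> 0 < e -> exists k, `|xs k t - x t| <= e.
  move=> t0 e0; have C0 : 0 <= 2 * a0 * expR (2 * K * t).
    by rewrite !mulr_ge0// expR_ge0.
  have [k Hk] := small _ _ C0 e0; exists k; apply: le_trans (conv k t t0) _.
  by rewrite mulrAC.
have x_max t : x (Num.max 0 t) = x t.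
  apply/rowP => i; rewrite !mxE.
  by under eq_fun do rewrite xs_max.
have x_lip s t : `|x t - x s| <= B * `|t - s|.
  have max0 (r : R) : 0 <= Num.max 0 r by rewrite le_max lexx.
  apply/ler_addgt0Pr => e e0.
  have c0 : 0 <= 2 * a0 * (expR (2 * K * Num.max 0 t) + expR (2 * K * Num.max 0 s)).
    by rewrite !mulr_ge0// addr_ge0// expR_ge0.
  have [k Hk] := small _ _ c0 e0.
  have := conv k _ (max0 t); rewrite xs_max x_max => Ht.
  have := conv k _ (max0 s); rewrite xs_max x_max => Hs.
  have -> : x t - x s = (xs k t - xs k s) - (xs k t - x t) + (xs k s - x s).
    have -> : xs k t - xs k s - (xs k t - x t) = x t - xs k s.
      by rewrite opprB addrC addrA subrK.
    by rewrite addrA subrK.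
  apply: le_trans (ler_normD _ _) _; apply: le_trans (lerD (ler_normB _ _) (lexx _)) _.
  have := xs_lip k s t; move: Hk; rewrite mulrAC mulrDr; lra.
have cx : continuous x by exact: lip_continuous.
exists x; split => // t t0 i; split; first exact: integrable_coord.
have fix_x : x t = step x t.
  apply/eqP; rewrite -subr_eq0 -normr_le0; apply/ler_addgt0Pr => e e0; rewrite add0r.
  have C0 : 0 <= 4 * a0 * expR (2 * K * t) by rewrite !mulr_ge0// expR_ge0.
  have [k Hk] := small _ _ C0 e0.
  have H1 := conv k.+1 t t0.
  have ck : 0 <= 2 * a0 / 2 ^+ k by rewrite divr_ge0 ?mulr_ge0 ?exprn_ge0.
  have H2 := @step_contraction (xs k) x _ (lip_continuous (xs_lip k)) cx ck
     (fun s s0 => conv k s s0) t t0.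
  have -> : x t - step x t = (step (xs k) t - step x t) - (xs k.+1 t - x t).
    by rewrite opprB [RHS]addrC addrA subrK.
  apply: le_trans (ler_normB _ _) _.
  move: H1 H2 Hk; rewrite exprS; set E := expR _; set P := 2 ^+ k.
  have P0 : P != 0 by rewrite expf_neq0.
  have -> : 2 * a0 / (2 * P) * E = a0 * E / P by field.
  have -> : 2 * a0 / P / 2 * E = a0 * E / P by field.
  have -> : 4 * a0 * E / P = 4 * (a0 * E / P) by field.
  have : 0 <= a0 * E / P by rewrite divr_ge0 ?mulr_ge0 ?expR_ge0 ?exprn_ge0.
  lra.
by rewrite [in LHS]fix_x mxE max_r.
Qed.

End picard.

(** * Truncation and solutions confined by an a priori bound *)

Lemma within_continuous_distP (R : realType) (U : normedModType R) (A : set R) (f : R -> U) :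
  {within A, continuous f} <-> forall t, A t -> forall e, 0 < e ->
    exists2 r, 0 < r & forall s, A s -> `|s - t| < r -> `|f s - f t| <= e.
Proof.
split=> [/(@within_continuousP _ U) cf t At e e0|H].
  have /cvgrPdist_le/(_ _ e0) := cf t At.
  rewrite near_withinE => /nbhs_ballP[r /= r0 Hr]; exists r => // s As st.
  by rewrite distrC; apply: Hr => //; rewrite /ball/= distrC.
apply/(@within_continuousP _ U) => t At; apply/cvgrPdist_le => e e0.
have [r r0 Hr] := H t At e e0; rewrite near_withinE; apply/nbhs_ballP.
exists r => //= s; rewrite /ball/= distrC => st As.
by rewrite distrC; exact: Hr.
Qed.

(** Close points use the local constant; points at distance at least [r / 2] use the boundedness of
    [F] on [A]. Letting the constant range near [+oo] in the covering form of compactness replaces a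
    finite subcover and a maximum. *)
Lemma lipschitz_on_compact (R : realType) (U W : normedModType R) (F : U -> W) (A : set U) :
  compact A -> (forall y, lipschitz_near F y) ->
  exists2 L : R, 0 < L & forall y z, A y -> A z -> `|F y - F z| <= L * `|y - z|.
Proof.
move=> cA lip.
have [B B0 HB] : exists2 B, 0 < B & forall y, A y -> `|F y| <= B.
  have : compact (F @` A).
    apply: continuous_compact => //; apply: continuous_subspaceT.
    exact: lipschitz_near_continuous.
  move=> /compact_bounded[M [_ HM]]; exists (`|M| + 1); first by rewrite ltr_wpDl.
  move=> y Ay; apply: (HM (`|M| + 1)); last by exists y.
  by rewrite (le_lt_trans (ler_norm _))// ltrDl.
have /compact_near_coveringP/(_ R (nbhs (+oo : set_system R))) cov := cA.
have {cov} : \forall M \near +oo, A `<=` [set y | forall z, A z -> `|F y - F z| <= M * `|y - z|].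
  apply: cov => y0 Ay0; have [L0 [r [L00 r0 H]]] := lip y0.
  have r20 : 0 < r / 2 by rewrite divr_gt0.
  near=> y M => z Az /=.
  have y0y : `|y - y0| < r / 2.
    by rewrite distrC; near: y; apply: (@cvgr_dist_lt _ U _ _ _ id y0).
  have [zr|zr] := ltP `|z - y0| r.
    apply: le_trans (H _ _ _ zr) _; first lra.
    rewrite ler_wpM2r//; near: M; apply: nbhs_pinfty_ge; exact: num_real.
  have yz : r / 2 <= `|y - z|.
    have -> : y - z = (y - y0) - (z - y0) by rewrite opprB addrA subrK.
    have := lerB_dist (z - y0) (y - y0); rewrite [`|z - y0 - _|]distrC; lra.
  have L0r : 0 <= L0 * r by rewrite mulr_ge0// ltW.
  (* [y] is near [y0] but need not lie in [A], so [F y] is bounded through [F y0]: [L0 * r] for the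
     passage, [B + B] for two points of [A]. *)
  apply: (@le_trans _ _ (L0 * r + (B + B))).
    rewrite -(subrK (F y0) (F y)) -addrA; apply: le_trans (ler_normD _ _) _.
    apply: lerD.
      have y0r : `|y0 - y0| < r by rewrite subrr normr0.
      have yr : `|y - y0| < r by lra.
      apply: le_trans (H _ _ yr y0r) _; rewrite ler_wpM2l// ltW//.
    by apply: le_trans (ler_normB _ _) _; rewrite lerD ?HB.
  have BM : (L0 * r + (B + B)) / (r / 2) <= M.
    by near: M; apply: nbhs_pinfty_ge; exact: num_real.
  have BB : 0 < B + B by lra.
  have M0 : 0 < M by apply: lt_le_trans BM; rewrite divr_gt0// ltr_wpDl.
  move: BM; rewrite ler_pdivrMr// => /le_trans; apply.
  by rewrite ler_pM2l.
move=> /pinfty_ex_gt0[L L0 HL]; exists L => // y z Ay Az; exact: HL.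
Unshelve. all: by end_near. Qed.

Lemma right_flowS (R : realType) (U : normedModType R) (F : U -> U) (S T : R) (x : R -> U) :
  S <= T -> right_flow F T x -> right_flow F S x.
Proof.
move=> ST [cx dx]; split.
  apply: continuous_subspaceW cx => t /=; rewrite !in_itv/= => /andP[-> tS].
  exact: le_trans ST.
by move=> t e /andP[t0 tS] e0; apply: dx => //; rewrite t0 (lt_le_trans tS).
Qed.

Section clamp.
Variables (R : realType) (n : nat) (b : R).
Hypothesis b0 : 0 < b.

(** The nonexpansive retraction onto the closed ball of radius [b] in the infinity norm. Composing a
    locally Lipschitz field with it gives a bounded, globally Lipschitz one. *)
Definition clamp_row (y : 'rV[R]_n) : 'rV[R]_n :=
  \row_i Num.max (- b) (Num.min b (y ord0 i)).

Lemma clamp_row_itv y i : - b <= clamp_row y ord0 i <= b.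
Proof.
have bb : - b <= b by rewrite -subr_ge0 opprK addr_ge0// ltW.
by rewrite mxE le_max lexx/= ge_max bb ge_min lexx.
Qed.

Lemma clamp_row_id y : `|y| <= b -> clamp_row y = y.
Proof.
move=> yb; apply/rowP => i; rewrite mxE.
have := le_trans (rV_coord_le y i) yb; rewrite ler_norml => /andP[y1 y2].
by rewrite min_r// max_r.
Qed.

Lemma clamp_row_lip y z : `|clamp_row y - clamp_row z| <= `|y - z|.
Proof.
apply: rV_norm_le => // i.
have := rV_coord_le (y - z) i; rewrite !mxE => /(le_trans _); apply.
set u := y ord0 i; set v := z ord0 i.
wlog uv : u v / u <= v => [H|].
  by have [/H//|/ltW/H] := leP u v; rewrite distrC [leRHS]distrC.
rewrite ler_distl; have -> : `|u - v| = v - u by rewrite ler0_norm ?opprB// subr_le0.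
by have [h1|h1] := leP b u; have [h2|h2] := leP b v;
  have [h3|h3] := leP (- b) b; have [h4|h4] := leP (- b) u; have [h5|h5] := leP (- b) v; lra.
Qed.

Lemma compact_box : compact [set v : 'rV[R]_n | forall i, - b <= v ord0 i <= b].
Proof.
have := @rV_compact R n (fun=> `[- b, b]%classic) (fun=> @segment_compact _ _ _).
congr compact; apply/seteqP; split => v /= H i; have := H i; by rewrite in_itv.
Qed.

End clamp.

(** The field is truncated outside radius [M + 1] and solved globally. As long as the solution stays
    within that radius it is a flow of [F], so the a priori bound improves [M + 1] to [M]; by
    continuity it cannot leave before [T]. *)
Lemma bounded_flow_exists (R : realType) n (F : 'rV[R]_n -> 'rV[R]_n)
    (x0 : 'rV[R]_n) (T M : R) :
  0 <= T -> (forall y, lipschitz_near F y) ->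
  (forall t y, 0 <= t <= T -> right_flow F t y -> y 0 = x0 -> `|y t| <= M) ->
  exists y : R -> 'rV[R]_n, [/\ continuous y, right_flow F T y, y 0 = x0 &
    forall t, 0 <= t <= T -> forall i,
    (@lebesgue_measure R).-integrable `[0, t] (EFin \o (fun s => F (y s) ord0 i)) /\
    y t ord0 i = x0 ord0 i + \int[@lebesgue_measure R]_(s in `[0, t]) F (y s) ord0 i].
Proof.
move=> T0 lipF apriori.
(* On the degenerate interval [[0, 0]] the constant curve is a flow vacuously, so the a priori bound
   applies to [x0]. *)
have M0 : 0 <= M.
  apply: le_trans (normr_ge0 (x0 : 'rV_n)) _.
  apply: (apriori 0 (fun=> x0)); rewrite ?lexx//; split.
    by apply: continuous_subspaceT => ?; exact: cvg_cst.
  by move=> t e /andP[t0 /(le_lt_trans t0)]; rewrite ltxx.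
have b0 : 0 < M + 1 by lra.
have [K K0 lipK] := lipschitz_on_compact (@compact_box R n (M + 1)) lipF.
pose G y := F (clamp_row (M + 1) y).
have inbox (y : 'rV[R]_n) :
    [set v : 'rV[R]_n | forall i, - (M + 1) <= v ord0 i <= M + 1] (clamp_row (M + 1) y).
  by move=> i; exact: clamp_row_itv.
have lipG y z : `|G y - G z| <= K * `|y - z|.
  apply: le_trans (lipK _ _ (inbox _) (inbox _)) _.
  by rewrite ler_pM2l// clamp_row_lip.
pose B := `|F 0| + K * (M + 1) + 1.
have B0 : 0 < B by rewrite ltr_wpDl// addr_ge0// mulr_ge0// ltW.
have bndG y : `|G y| <= B.
  have box0 : [set v : 'rV[R]_n | forall i, - (M + 1) <= v ord0 i <= M + 1] 0.
    by move=> i; rewrite mxE; lra.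
  rewrite /G -[F _](subrK (F 0)); apply: le_trans (ler_normD _ _) _.
  have := lipK _ _ (inbox y) box0; rewrite subr0.
  have : K * `|clamp_row (M + 1) y| <= K * (M + 1).
    rewrite ler_pM2l//; apply: rV_norm_le; first exact: ltW.
    by move=> i; rewrite ler_norml; exact: clamp_row_itv.
  rewrite /B; lra.
have [y [cy Hy]] := picard_lindelof x0 K0 B0 lipG bndG.
have y0 : y 0 = x0.
  by apply/rowP => i; have [_ ->] := Hy 0 (lexx 0) i; rewrite set_itv1 Rintegral_set1 addr0.
have cG : continuous G.
  apply/continuous_distP => z e e0; exists (e / K); first exact: divr_gt0.
  move=> z'; rewrite ltr_pdivlMr// mulrC => zz.
  exact: le_trans (lipG _ _) (ltW zz).
have flowG S : right_flow G S y.
  split; first exact: continuous_subspaceT.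
  apply: (integral_curve_right_slope cG); first exact: continuous_subspaceT.
  by move=> t /andP[t0 _]; exact: Hy.
have flowF S : (forall s, 0 <= s < S -> `|y s| <= M + 1) -> right_flow F S y.
  move=> bnd; have [c d] := flowG S; split => // t e tS e0.
  have := d t e tS e0; rewrite /G clamp_row_id//; exact: bnd.
have cdist := iffLR (@continuous_distP R R^o _ y) cy.
have bound : forall s, 0 <= s <= T -> `|y s| <= M + 1.
  pose A := [set t | 0 <= t <= T /\ forall s, 0 <= s <= t -> `|y s| <= M + 1].
  have A0 : A 0.
    split; first by rewrite lexx.
    move=> s s0; have -> : s = 0 by lra.
    have : `|y 0| <= M.
      apply: apriori => //; first by rewrite lexx.
      by apply: flowF => s'; lra.
    lra.
  have hA : has_sup A by split; [exists 0|exists T => t [/andP[]]].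
  set S := sup A.
  have S0 : 0 <= S by apply: ub_le_sup => //; case: hA.
  have ST : S <= T by apply: ge_sup; [exists 0|move=> t [/andP[]]].
  have below s : 0 <= s < S -> `|y s| <= M + 1.
    move=> /andP[s0 sS]; have d0 : 0 < S - s by lra.
    have [t [_ At] st] := sup_adherent d0 hA.
    by apply: At; rewrite s0/=; rewrite -/S in st; lra.
  (* Being a flow up to [S] constrains slopes only at times before [S], so the bound on [[0, S)]
     suffices. The margin 1 gained here lets the bound persist up to [S + r / 2], which forces
     [S = T]. *)
  have yS : `|y S| <= M.
    apply: apriori => //; first by rewrite S0.
    exact: flowF.
  have [r r0 Hr] := cdist S 1 ltr01.
  have near_S s : `|s - S| < r -> `|y s| <= M + 1.
    move=> /Hr ys; have -> : y s = y S + (y s - y S) by rewrite addrC subrK.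
    by apply: le_trans (ler_normD _ _) _; lra.
  have AS' : A (Num.min T (S + r / 2)).
    have rr : 0 < r / 2 by rewrite divr_gt0.
    split; first by rewrite ge_min lexx/= le_min T0/=; lra.
    move=> s /andP[s0]; rewrite le_min => /andP[sT sS].
    have [sS'|sS'] := ltP s S; first by apply: below; rewrite s0.
    by apply: near_S; rewrite ger0_norm ?subr_ge0//; lra.
  have : Num.min T (S + r / 2) <= S by apply: ub_le_sup => //; case: hA.
  have rr : 0 < r / 2 by rewrite divr_gt0.
  rewrite ge_min => /orP[TS|]; last lra.
  have ES : S = T by lra.
  move=> s /andP[s0 sT]; have [s'|s'] := ltP s S; first by apply: below; rewrite s0.
  have -> : s = S by lra.
  lra.
exists y; split => //.
  by apply: flowF => s /andP[s0 sT]; apply: bound; rewrite s0 ltW.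
move=> t /andP[t0 tT] i; have [ig ->] := Hy t t0 i.
have E : {in `[0, t], forall s, G (y s) ord0 i = F (y s) ord0 i}.
  move=> s; rewrite in_itv/= => /andP[s0 st].
  by rewrite /G clamp_row_id// bound// s0 (le_trans st).
split.
  apply: eq_integrable ig => // s; rewrite inE/= => sI; congr EFin; exact: E.
congr (_ + _); apply: eq_Rintegral => s; rewrite inE/= => sI; exact: E.
Qed.

(** * Simulation function *)

Section comparison_function_lemmas.
Variable R : realType.
Implicit Types a b : R -> R.

Lemma Kinf_ge0 a r : Kinf a -> 0 <= r -> 0 <= a r.
Proof.
move=> [_ a0 inc _]; rewrite le_eqVlt => /predU1P[<-|r0]; first by rewrite a0.
by rewrite -a0 ltW// inc.
Qed.

Lemma Kinf_le a r s : Kinf a -> 0 <= r -> r <= s -> a r <= a s.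
Proof.
move=> [_ _ inc _] r0; rewrite le_eqVlt => /predU1P[<-//|rs].
by rewrite ltW// inc.
Qed.

Lemma KinfD a b : Kinf a -> Kinf b -> Kinf (fun r => a r + b r).
Proof.
move=> ka kb; have [ca a0 ia ua] := ka; have [cb b0 ib ub] := kb; split.
- apply/(@within_continuousP _ R^o) => t tI.
  by apply: cvgD; [move/(@within_continuousP _ R^o): ca
    |move/(@within_continuousP _ R^o): cb]; apply.
- by rewrite a0 b0 addr0.
- by move=> r s r0 rs; rewrite ltrD// ?ia ?ib.
- move=> M; have [r r0 Mr] := ua M; exists r => //.
  by rewrite (lt_le_trans Mr)// lerDl Kinf_ge0.
Qed.

Lemma Kinf_scale a c d : 0 < c -> 0 < d -> Kinf a -> Kinf (fun r => c * a (d * r)).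
Proof.
move=> c0 d0 [ca a0 ia ua]; split.
- apply/within_continuous_distP => t; rewrite /= in_itv/= andbT => t0 e e0.
  have dt : `[0, +oo[%classic (d * t) by rewrite /= in_itv/= andbT mulr_ge0// ltW.
  have ec : 0 < e / c by rewrite divr_gt0.
  have [r r0 H] := iffLR (@within_continuous_distP R R^o _ a) ca _ dt _ ec.
  exists (r / d) => [|s]; first exact: divr_gt0.
  rewrite in_itv/= andbT ltr_pdivlMr// => s0 st.
  rewrite -mulrBr normrM gtr0_norm// mulrC -ler_pdivlMr//; apply: H.
    by rewrite /= in_itv/= andbT mulr_ge0// ltW.
  by rewrite -mulrBr normrM gtr0_norm// mulrC.
- by rewrite mulr0 a0 mulr0.
- move=> r s r0 rs; rewrite ltr_pM2l//; apply: ia; first by rewrite mulr_ge0// ltW.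
  by rewrite ltr_pM2l.
- move=> M; have [r r0 Mr] := ua (M / c); exists (r / d).
    by rewrite divr_ge0// ltW.
  by rewrite mulrCA mulfV ?gt_eqF// mulr1 mulrC -ltr_pdivrMr.
Qed.

End comparison_function_lemmas.

Lemma quantize_round (R : realType) k (eta : R) (y : 'rV[R]_k) : 0 <= eta ->
  exists2 y', quantize [set: 'rV[R]_k] eta y' & `|y' - y| <= eta.
Proof.
move=> eta0; rewrite /quantize; case: eqP => [->|/eqP eta_neq0].
  by exists y => //; rewrite subrr normr0.
have eta_gt0 : 0 < eta by rewrite lt_def eta_neq0.
exists (\row_i ((Num.floor (y ord0 i / eta))%:~R * eta)).
  by split => // i; exists (Num.floor (y ord0 i / eta)); rewrite mxE.
apply: rV_norm_le => // i; rewrite !mxE.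
have /andP[] := Num.Theory.floor_itv (y ord0 i / eta).
rewrite ler_pdivlMr// ltr_pdivrMr// intrD => l1; rewrite mulrDl mul1r => l2.
by rewrite ler_distl; apply/andP; split; lra.
Qed.

Lemma quantize_sub (R : realType) k (eta : R) (A : set 'rV[R]_k) : quantize A eta `<=` A.
Proof. by rewrite /quantize; case: ifP => _ x //; case. Qed.

(** Local Lipschitz continuity is phrased on neighbourhoods in the space of pairs; evaluating it at
    the diagonal point [(y, y)] gives a radius and a constant. *)
Lemma lipschitz_near_locally (R : realType) (U W : normedModType R) (A : set U)
    (F : U -> W) (y : U) :
  [locally [lipschitz F z | z in A]] -> A y ->
  exists K r : R, [/\ 0 <= K, 0 < r & forall z z', A z -> A z' ->
    `|z - y| < r -> `|z' - y| < r -> `|F z - F z'| <= K * `|z - z'|].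
Proof.
move=> lip Ay; have := lip (y, y) (conj Ay Ay).
move=> /pinfty_ex_gt0[K K0 HK].
have /nbhs_ballP[r /= r0 H] : nbhs (y, y) (fun z => (A `*` A) z ->
    `|F z.1 - F z.2| <= K * `|z.1 - z.2|) := HK.
exists K, r; split; [exact: ltW|by []|] => z z' Az Az' zr zr'.
apply: (H (z, z')) => //=.
by split; rewrite -ball_normE/= distrC.
Qed.

Lemma prod_normE (R : realType) (U W : normedModType R) (z : U * W) :
  `|z| = Num.max `|z.1| `|z.2|.
Proof. by []. Qed.

Lemma lipschitz_near_dynamics (R : realType) n q m (W : set 'rV[R]_q) (U : set 'rV[R]_m)
    (f : 'rV[R]_n -> 'rV[R]_q -> 'rV[R]_m -> 'rV[R]_n) w u :
  locally_lipschitz_dynamics W U f -> W w -> U u ->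
  forall y, lipschitz_near (fun x => f x w u) y.
Proof.
move=> lip Ww Uu y.
have [//|K [r [K0 r0 H]]] := lipschitz_near_locally (y := ((y, w), u)) lip.
have dist (z z' : 'rV[R]_n) : `|((z, w), u) - ((z', w), u) : 'rV_n * 'rV_q * 'rV_m| = `|z - z'|.
  have -> : ((z, w), u) - ((z', w), u) = ((z - z', 0), 0) :> 'rV_n * 'rV_q * 'rV_m.
    by rewrite [LHS](_ : _ = ((z - z', w - w), u - u))// !subrr.
  by rewrite !prod_normE/= !normr0 !max_l// le_max normr_ge0.
exists K, r; split => // z z' zr zr'.
have := H ((z, w), u) ((z', w), u); rewrite !dist; exact.
Qed.

(** There are finitely many counters, so the largest ratio [kd / g c] is still below 1. Starting the
    maximum at [1/2] keeps it positive even when [kd <= 0]. *)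
Lemma uniform_contraction (R : realType) (kd : R) (g : nat -> R) (zlo zhi : nat) :
  (forall c, 0 < g c) -> (forall c, (zlo <= c <= zhi)%N -> kd < g c) ->
  exists2 sigma, 0 < sigma < 1 & forall c, (zlo <= c <= zhi)%N -> kd <= sigma * g c.
Proof.
move=> g0 H; exists (\big[Num.max/2^-1]_(c < zhi.+1 | (zlo <= c)%N) (kd / g c)).
  rewrite (@lt_le_trans _ _ 2^-1) ?invr_gt0 ?ltr0n//=; last exact: bigmax_ge_id.
  apply/bigmax_ltP; split; first by rewrite invf_lt1 ?ltr1n.
  by move=> c cz; rewrite ltr_pdivrMr// mul1r H// cz -ltnS ltn_ord.
move=> c /andP[c1 c2]; rewrite -ler_pdivrMr//.
exact: (@le_bigmax_cond _ _ _ _ (Ordinal (c2 : (c < zhi.+1)%N)) _ (fun c : 'I_zhi.+1 => kd / g c)).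
Qed.

(** The three regimes are merged into one weight [e^(a c)]. The last two conditions on [a] say that
    flows contract and that the weight lost when a jump resets the counter beats [kd]. *)
Lemma dwell_time_parameters (R : realType) n (V : 'rV[R]_n -> 'rV[R]_n -> R)
    (kc kd tau : R) (zlo zhi : nat) :
  0 < tau -> (1 <= zlo)%N -> (zlo <= zhi)%N ->
  (forall c : nat, c = zlo \/ c = zhi -> ln kd - kc * tau * c%:R < 0) ->
  exists epsilon delta a : R,
  [/\ 0 < epsilon < 1, zhi%:R < delta,
      (forall s sh, calV V kc kd tau epsilon delta s sh =
         V s.1 sh.1 * expR (a * s.2%:R)),
      a - kc * tau < 0 &
      (forall c, (zlo <= c <= zhi)%N -> kd < expR (a * c%:R))].
Proof.
move=> tau0 zlo1 zlohi dwell.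
have dlo := dwell zlo (or_introl erefl).
have dhi := dwell zhi (or_intror erefl).
have zlo0 : 0 < zlo%:R :> R by rewrite ltr0n.
have zhi0 : 0 < zhi%:R :> R by rewrite ltr0n (leq_trans zlo1).
have [kd1|kd1] := ltP kd 1; have [kc0|kc0] := ltP 0 kc.
(* Both flows and jumps contract, so the weight is constant and any admissible [epsilon] and [delta]
   serve. *)
- exists 2^-1, (zhi%:R + 1), 0; split.
  + by rewrite invr_gt0 ltr0n invf_lt1 ?ltr1n.
  + by rewrite ltrDl.
  + by move=> s sh; rewrite /calV kd1 kc0 mul0r expR0 mulr1.
  + by rewrite sub0r oppr_lt0 mulr_gt0.
  + by move=> c _; rewrite mul0r expR0.
- have tkc : kc * tau <= 0 by rewrite pmulr_lle0.
  have tkcz : kc * tau * zhi%:R <= 0 by rewrite pmulr_lle0.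
  have lnkd : ln kd < 0 by lra.
  (* For [kd <= 0] the value of [ln kd] is 0 by convention, which the strict inequality excludes. *)
  have kd0 : 0 < kd by rewrite ltNge; apply/negP => /ln0 H; move: lnkd; rewrite H ltxx.
  (* The flow needs [ln kd < kc * tau * delta], which holds with a gap at [delta = zhi]. Moving
     [delta] by [theta] consumes at most half of this gap; the summand 1 keeps the denominator
     positive when [kc = 0]. *)
  pose theta := (kc * tau * zhi%:R - ln kd) / (2 * (1 - kc * tau)).
  have th0 : 0 < theta by rewrite divr_gt0 ?subr_gt0//; lra.
  have delta0 : 0 < zhi%:R + theta by rewrite addr_gt0.
  exists 2^-1, (zhi%:R + theta), (ln kd / (zhi%:R + theta)); split.
  + by rewrite invr_gt0 ltr0n invf_lt1 ?ltr1n.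
  + by rewrite ltrDl.
  + move=> s sh; rewrite /calV kd1 [0 < kc]ltNge kc0 [1 <= kd]leNgt kd1/=.
    rewrite powRN invrK /powR gt_eqF//; congr (_ * expR _).
    by ring.
  + rewrite subr_lt0 ltr_pdivrMr// mulrDr.
    have -> : kc * tau * theta = theta - (1 - kc * tau) * theta by ring.
    have -> : (1 - kc * tau) * theta = (kc * tau * zhi%:R - ln kd) / 2.
      by rewrite /theta; field; apply/eqP; lra.
    lra.
  + move=> c /andP[_ czhi]; rewrite -{1}(lnK kd0) ltr_expR.
    rewrite mulrAC ltr_pdivlMr// -subr_gt0 -mulrBr nmulr_rgt0// subr_lt0.
    by rewrite (@le_lt_trans _ _ zhi%:R) ?ler_nat// ltrDl.
- have kd0 : 0 < kd by exact: lt_le_trans kd1.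
  have lnkd : 0 <= ln kd by exact: ln_ge0.
  have kct : 0 < kc * tau by rewrite mulr_gt0.
  have kctz : 0 < kc * tau * zlo%:R by rewrite mulr_gt0.
  (* The inequality at [zlo] says [r < 1]. Any [epsilon] strictly between works, here the midpoint:
     [epsilon < 1] serves the flow, [epsilon > r] the jumps, the worst of which occurs at
     [c = zlo]. *)
  pose r := ln kd / (kc * tau * zlo%:R).
  have r0 : 0 <= r by rewrite divr_ge0// ltW.
  have r1 : r < 1 by rewrite /r ltr_pdivrMr// mul1r -subr_lt0.
  exists ((r + 1) / 2), (zhi%:R + 1), (kc * tau * ((r + 1) / 2)); split.
  + by apply/andP; split; lra.
  + by rewrite ltrDl.
  + move=> s sh; rewrite /calV ltNge kd1/= kc0 -expRN; congr (_ * expR _).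
    by ring.
  + by rewrite -[X in _ - X]mulr1 -mulrBr pmulr_rlt0//; lra.
  + move=> c /andP[cz _]; rewrite -{1}(lnK kd0) ltr_expR.
    have -> : ln kd = kc * tau * zlo%:R * r by rewrite /r mulrC divfK// gt_eqF.
    apply: (@lt_le_trans _ _ (kc * tau * ((r + 1) / 2) * zlo%:R)).
      rewrite [ltRHS]mulrAC ltr_pM2l//; lra.
    rewrite ler_wpM2l ?ler_nat//; apply: mulr_ge0; first exact: ltW.
    lra.
(* Neither flows nor jumps contract, contradicting the inequality at [zhi]. *)
- exfalso; have : 0 <= ln kd by exact: ln_ge0.
  have : kc * tau * zhi%:R <= 0 by rewrite !pmulr_lle0.
  lra.
Qed.

(** A concrete flow step prescribes only a left limit at [T]. Taking it as endpoint value gives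
    continuity on the closed interval and leaves right slopes before [T] unchanged. *)
Lemma right_flow_extend (R : realType) (U : normedModType R) (F : U -> U) (T : R)
    (x : R -> U) (l : U) :
  0 < T -> {within `[0, T[, continuous x} -> x t @[t --> T^'-] --> l ->
  (forall t e, 0 <= t < T -> 0 < e ->
    \forall h \near 0^'+, `|x (t + h) - x t - h *: F (x t)| <= h * e) ->
  right_flow F T (fun t => if t < T then x t else l).
Proof.
move=> T0 cx xl dx; split.
  apply/within_continuous_distP => t; rewrite /= in_itv/= => /andP[t0 tT] e e0.
  have [tT'|tT'] := ltP t T.
    have tI : `[0, T[%classic t by rewrite /= in_itv/= t0.
    have [r r0 H] := iffLR (within_continuous_distP _ _) cx t tI e e0.
    exists (Num.min r (T - t)); first by rewrite lt_min r0 subr_gt0.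
    move=> s; rewrite in_itv/= lt_min => /andP[s0 _] /andP[sr].
    rewrite ltr_norml => /andP[_ sT].
    have sT' : s < T by lra.
    by rewrite sT'; apply: H => //; rewrite /= in_itv/= s0.
  have -> : t = T by apply/eqP; rewrite eq_le tT tT'.
  move/cvgrPdist_le/(_ _ e0): xl => /nbhs_ballP[r /= r0 H].
  exists r => // s; rewrite in_itv/= => /andP[s0 _] sT.
  case: ifPn => [sT'|_]; last by rewrite subrr normr0 ltW.
  by rewrite distrC; apply: H => //; rewrite /ball/= distrC.
move=> t e /andP[t0 tT] e0; near=> h.
have hT : h < T - t by near: h; apply: nbhs_right_lt; rewrite subr_gt0.
rewrite tT ifT; last lra.
by near: h; apply: dx => //; rewrite t0.
Unshelve. all: by end_near. Qed.

Lemma right_flow_bounded (R : realType) (U : normedModType R) (F : U -> U) (T : R)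
    (x : R -> U) :
  right_flow F T x -> exists B : R, forall t, 0 <= t <= T -> `|x t| <= B.
Proof.
move=> [cx _]; have : compact (x @` `[0, T]).
  by apply: continuous_compact => //; exact: segment_compact.
move=> /compact_bounded[M [_ HM]]; exists (`|M| + 1) => t tT.
apply: (HM (`|M| + 1)); last by exists t => //; rewrite /= in_itv.
by rewrite (le_lt_trans (ler_norm _))// ltrDl.
Qed.

(** * Lyapunov estimates for pairs of trajectories *)

Section incremental_lyapunov.
Variables (R : realType) (n : nat) (V : 'rV[R]_n -> 'rV[R]_n -> R).
Variables (F1 F2 : 'rV[R]_n -> 'rV[R]_n) (k rho : R).
Hypothesis rho0 : 0 <= rho.
Hypothesis lipV : forall z : 'rV[R]_n * 'rV[R]_n,
  lipschitz_near (fun z => V z.1 z.2 : R^o) z.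
Hypothesis lipF1 : forall y, lipschitz_near F1 y.
Hypothesis lipF2 : forall y, lipschitz_near F2 y.
Hypothesis dV : almost_every_pair (fun x y : 'rV[R]_n =>
     differentiable (fun z : 'rV[R]_n * 'rV[R]_n => V z.1 z.2 : R^o) (x, y) /\
     'd (fun z => V z y : R^o) x (F1 x) + 'd (fun z => V x z : R^o) y (F2 y)
     <= - k * V x y + rho).

Lemma lyapunov_decay (T : R) (x y : R -> 'rV[R]_n) :
  0 <= T -> right_flow F1 T x -> right_flow F2 T y ->
  V (x T) (y T) <= expR (- k * T) * V (x 0) (y 0) + rho * (T * expR (`|k| * T) ^+ 2).
Proof.
move=> T0 fx fy.
have slope (z : 'rV[R]_n * 'rV[R]_n) e : 0 < e -> \forall h \near 0^'+,
    (fun z => V z.1 z.2 : R^o) (z + h *: (F1 z.1, F2 z.2)) <=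
    (fun z => V z.1 z.2 : R^o) z + h * (- k * V z.1 z.2 + rho + e).
  move=> e0; apply: (pair_slope_ae lipV _ _ dV z.1 z.2 e0).
    exact: lipschitz_near_continuous.
  exact: lipschitz_near_continuous.
exact: (right_flow_decay T0 rho0 lipV slope (right_flow_pair fx fy)).
Qed.

Hypothesis V0 : forall x y, 0 <= V x y.
Variable alo : R -> R.
Hypothesis Kalo : Kinf alo.
Hypothesis aloV : forall x y, alo `|x - y| <= V x y.

(** Decay along pairs keeps [V (x t) (y t)] below a constant [C] valid for all [t <= T]. As [alo] is
    unbounded, some [r] has [C < alo r], so [y] stays within [r] of the bounded curve [x]: this is
    the a priori bound. *)
Lemma lyapunov_flow_exists (T : R) (x : R -> 'rV[R]_n) (y0 : 'rV[R]_n) :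
  0 <= T -> right_flow F1 T x ->
  exists y : R -> 'rV[R]_n, [/\ continuous y, right_flow F2 T y, y 0 = y0 &
    forall t, 0 <= t <= T -> forall i,
    (@lebesgue_measure R).-integrable `[0, t] (EFin \o (fun s => F2 (y s) ord0 i)) /\
    y t ord0 i = y0 ord0 i + \int[@lebesgue_measure R]_(s in `[0, t]) F2 (y s) ord0 i].
Proof.
move=> T0 fx; have [B HB] := right_flow_bounded fx.
pose E := expR (`|k| * T); pose C := E * V (x 0) y0 + rho * (T * E ^+ 2).
have [_ _ inc /(_ C)[r r0 Cr]] := Kalo.
apply: (@bounded_flow_exists _ _ F2 y0 T (B + r)) => // t y /andP[t0 tT] fy y0E.
have Et : expR (`|k| * t) <= E by rewrite ler_expR ler_wpM2l.
have Ekt : expR (- k * t) <= E.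
  by apply: le_trans Et; rewrite ler_expR ler_wpM2r// (le_trans (ler_norm _))// normrN.
have VC : V (x t) (y t) <= C.
  apply: le_trans (lyapunov_decay t0 (right_flowS tT fx) fy) _.
  rewrite y0E lerD// ?ler_wpM2r// ler_wpM2l// ler_pM//.
  by rewrite lerXn2r// nnegrE expR_ge0.
have xyr : `|x t - y t| < r.
  rewrite ltNge; apply/negP => /(Kinf_le Kalo r0).
  have := aloV (x t) (y t); lra.
have -> : y t = x t - (x t - y t) by rewrite subKr.
apply: le_trans (ler_normB _ _) _; apply: lerD; last exact: ltW.
by apply: HB; rewrite t0.
Qed.

End incremental_lyapunov.

Theorem theorem4p6 (R : realType) (n q m p : nat)
  (tau : R) (zlo zhi : nat) (etax etaw etau : R)
  (S : impulsive_subsystem R n q m p)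
  (htau : 0 < tau) (hzlo : (1 <= zlo)%N) (hz : (zlo <= zhi)%N)
  (hetax : 0 <= etax) (hetaw : 0 <= etaw) (hetau : 0 <= etau)
  (hS : sampled_impulsive_subsystem tau zlo zhi S)
  (L : R) (hL : 0 < L)
  (A1 : forall x y, `|is_h S x - is_h S y| <= L * `|x - y|)
  (V : 'rV[R]_n -> 'rV[R]_n -> R)
  (hV0 : forall x xh, 0 <= V x xh)
  (hVlip : [locally [lipschitz (V z.1 z.2 : R^o) |
                       z in [set: 'rV[R]_n * 'rV[R]_n]]])
  (alo ahi rhowc rhowd rhouc rhoud : R -> R) (kc kd : R)
  (halo : Kinf alo) (hahi : Kinf ahi)
  (hrhowc : Kinf rhowc) (hrhowd : Kinf rhowd)
  (hrhouc : Kinf rhouc) (hrhoud : Kinf rhoud)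
  (A2bounds : forall x xh, alo `|x - xh| <= V x xh <= ahi `|x - xh|)
  (A2flow : almost_every_pair (fun x xh : 'rV[R]_n =>
     differentiable (fun z : 'rV[R]_n * 'rV[R]_n => V z.1 z.2 : R^o) (x, xh) /\
     forall w wh u uh, is_W S w -> is_W S wh -> is_U S u -> is_U S uh ->
     'd (fun y => V y xh : R^o) x (is_f S x w u)
       + 'd (fun y => V x y : R^o) xh (is_f S xh wh uh)
     <= - kc * V x xh + rhowc `|w - wh| + rhouc `|u - uh|))
  (A2jump : forall x xh w wh u uh,
     is_W S w -> is_W S wh -> is_U S u -> is_U S uh ->
     V (is_g S x w u) (is_g S xh wh uh)
     <= kd * V x xh + rhowd `|w - wh| + rhoud `|u - uh|)
  (gammah : R -> R) (hgammah : Kinf gammah)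
  (A3 : forall x y z, V x y <= V x z + gammah `|y - z|)
  (hdwell : forall c : nat, c = zlo \/ c = zhi ->
     ln kd - kc * tau * c%:R < 0) :
  exists epsilon delta : R,
  [/\ 0 < epsilon < 1,
      zhi%:R < delta &
      local_alternating_simulation
        (That_tau tau zlo zhi etax etaw etau S) (T_tau tau zlo zhi S)
        (@same_counter R n) (calV V kc kd tau epsilon delta)].
Proof.
have [_ lf lg _ _] := hS.
have [eps [del [a [he hd EV afl ajp]]]] := dwell_time_parameters V htau hzlo hz hdwell.
exists eps, del; split => //.
have [sj /andP[sj0 sj1] Hsj] := uniform_contraction (fun c => expR_gt0 (a * c%:R)) ajp.
(* [sf] is the contraction factor of a flow step, [sj] that of all jumps; [sigma] is the larger
   one. *)
pose sf := expR (a - kc * tau).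
have sf1 : sf < 1 by rewrite -expR0 ltr_expR.
pose sigma := Num.max sj sf.
have sj_le : sj <= sigma by rewrite le_max lexx.
have sf_le : sf <= sigma by rewrite le_max lexx orbT.
(* Bounds the weight [e^(a c)] over all counters, and its inverse bounds it from below. *)
pose Em := expR (`|a| * zhi%:R).
have Em0 : 0 < Em by exact: expR_gt0.
have ac_le c : (c <= zhi)%N -> `|a * c%:R| <= `|a| * zhi%:R.
  by move=> cz; rewrite normrM ler_wpM2l// ger0_norm// ler_nat.
have EmP c : (c <= zhi)%N -> expR (a * c%:R) <= Em.
  by move=> /ac_le H; rewrite ler_expR (le_trans (ler_norm _)).
have Em1 : 1 <= Em by have := EmP 0%N isT; rewrite mulr0 expR0.
(* The gain with which a constant input mismatch enters over one flow step of length [tau]. *)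
pose C1 := tau * expR (`|kc| * tau) ^+ 2.
have C10 : 0 < C1 by rewrite mulr_gt0// exprn_gt0// expR_gt0.
have EmC1 : 0 < Em * C1 by rewrite mulr_gt0.
have g0 : 0 <= gammah etax by exact: Kinf_ge0.
have lipV (z : 'rV[R]_n * 'rV[R]_n) : lipschitz_near (fun z => V z.1 z.2 : R^o) z.
  have [//|K [r [K0 r0 H]]] := lipschitz_near_locally (y := z) hVlip.
  by exists K, r; split => // y y' yr yr'; exact: H.
have V_round x y y' : `|y' - y| <= etax -> V x y' <= V x y + gammah etax.
  move=> yy; apply: le_trans (A3 x y' y) _; rewrite lerD2l.
  exact: Kinf_le.
split => //.
- exact: quantize_sub.
- by move=> s sh _ _ _; rewrite EV mulr_ge0 ?expR_ge0.
(* The output bound passes through the Lipschitz constant [L] and the least weight. The internal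
   gain adds the flow and jump gains so as to serve both cases, and [eps] accounts for rounding to
   the grid. *)
exists (fun r => expR (- (`|a| * zhi%:R)) * alo (L^-1 * r)),
  (fun r => Em * C1 * rhowc (1 * r) + Em * rhowd (1 * r)), (fun=> 0), sigma,
  (Em * gammah etax); split.
- split; last by rewrite mulr_ge0// ltW.
  + by apply: Kinf_scale; rewrite ?expR_gt0 ?invr_gt0.
  + by apply: KinfD; apply: Kinf_scale.
  + by rewrite lt_max sj0/= gt_max sj1.
  + by right.
- move=> s sh sX _ _; rewrite EV [X in X <= _]mulrC.
  have nx : 0 <= L^-1 * `|is_h S s.1 - is_h S sh.1| by rewrite mulr_ge0// invr_ge0 ltW.
  apply: ler_pM; rewrite ?expR_ge0//; first exact: Kinf_ge0.
    have /andP[aV _] := A2bounds s.1 sh.1; apply: le_trans aV.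
    by apply: Kinf_le => //; rewrite ler_pdivrMl//; exact: A1.
  by rewrite ler_expR; have := ac_le _ sX; rewrite ler_norml => /andP[].
move=> s sh uh sX [gsh shX] ssh Uuh.
have Uu : is_U S uh by exact: quantize_sub Uuh.
(* A quantized input is itself a concrete input; with [u = uh] both external gains are evaluated at
   0. *)
exists uh => // w wh s' Ww Wwh' F.
have Wwh : is_W S wh by exact: quantize_sub Wwh'.
have nw : 0 <= `|w - wh| by [].
have rwc := Kinf_ge0 hrhowc nw.
have rwd := Kinf_ge0 hrhowd nw.
have V0 := hV0 s.1 sh.1.
rewrite !mul1r addr0.
have S0 : 0 <= calV V kc kd tau eps del s sh by rewrite EV mulr_ge0 ?expR_ge0.
have lF1 := lipschitz_near_dynamics lf Ww Uu.
have lF2 := lipschitz_near_dynamics lf Wwh Uu.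
case: F => [[cz [x [cx Hx] xl] c1]|[cz gE c0]].
- have dx : forall t e, 0 <= t < tau -> 0 < e ->
     \forall h \near 0^'+, `|x (t + h) - x t - h *: is_f S (x t) w uh| <= h * e.
    apply: (integral_curve_right_slope (x0 := s.1) (lipschitz_near_continuous lF1) cx).
    by move=> t tt i; apply: Hx; rewrite /= in_itv.
  have fx := right_flow_extend (F := fun z => is_f S z w uh) htau cx xl dx.
  set xb := (fun t => if t < tau then x t else s'.1) in fx.
  have xb0 : xb 0 = s.1.
    rewrite /xb htau; apply/rowP => i.
    have [|_ ->] := Hx 0 _ i; first by rewrite /= in_itv/= lexx.
    by rewrite set_itv1 Rintegral_set1 addr0.
  have xbT : xb tau = s'.1 by rewrite /xb ltxx.
  (* The inputs are now fixed, so this exceptional set lies inside the one for all inputs. *)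
  have dV : almost_every_pair (fun x y : 'rV[R]_n =>
     differentiable (fun z : 'rV[R]_n * 'rV[R]_n => V z.1 z.2 : R^o) (x, y) /\
     'd (fun z => V z y : R^o) x (is_f S x w uh) + 'd (fun z => V x z : R^o) y (is_f S y wh uh)
     <= - kc * V x y + rhowc `|w - wh|).
    apply: null_setS A2flow => _ [z /= nQ <-]; exists z => //= -[dif Q].
    apply: nQ; split => //; have := Q w wh uh uh Ww Wwh Uu Uu.
    have [_ rhouc0 _ _] := hrhouc.
    by rewrite subrr normr0 rhouc0 addr0.
  have aloV y y' : alo `|y - y'| <= V y y' by have /andP[] := A2bounds y y'.
  have [y [cy fy y0 Hy]] :=
    lyapunov_flow_exists rwc lipV lF1 lF2 dV hV0 halo aloV sh.1 (ltW htau) fx.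
  have := lyapunov_decay rwc lipV lF1 lF2 dV (ltW htau) fx fy.
  rewrite xb0 xbT y0 -/C1 => dec.
  have [yq gq yqy] := quantize_round (y tau) hetax.
  have zhi1 : (1 <= zhi)%N by exact: leq_trans hz.
  (* Subtraction on naturals is truncated, so [1 <= zhi] is what makes [s.2 <= zhi - 1] leave room
     for the increment. *)
  have c1z : (s'.2 <= zhi)%N by rewrite c1 addn1 -[zhi](subnK zhi1) addn1 ltnS.
  exists (yq, s'.2); split => //=.
    split => //; left; split; rewrite -?ssh//.
    exists y => //; split; first exact: continuous_subspaceT.
    by move=> t; rewrite /= in_itv/=; exact: Hy.
  rewrite !EV/=.
  set e' := expR (a * s'.2%:R).
  have e'0 : 0 <= e' by exact: expR_ge0.
  have e'E : e' <= Em by exact: EmP.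
  (* The counter increment contributes a factor [e^a], which combines with the decay of [V] into
     [sf]. *)
  have De' : expR (- kc * tau) * e' = sf * expR (a * s.2%:R).
    by rewrite /e' /sf -!expRD c1 natrD; congr expR; ring.
  have rwC : 0 <= rhowc `|w - wh| * C1 by rewrite mulr_ge0// ltW.
  have K1 : V s'.1 yq * e' <=
      (expR (- kc * tau) * V s.1 sh.1 + rhowc `|w - wh| * C1 + gammah etax) * e'.
    rewrite ler_wpM2r//; apply: le_trans (V_round s'.1 _ _ yqy) _.
    by rewrite lerD2r.
  have K2 : (rhowc `|w - wh| * C1 + gammah etax) * e' <=
      (rhowc `|w - wh| * C1 + gammah etax) * Em by rewrite ler_wpM2l// addr_ge0.
  have K3 : expR (- kc * tau) * V s.1 sh.1 * e' <= sigma * (V s.1 sh.1 * expR (a * s.2%:R)).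
    rewrite mulrAC De' mulrAC -mulrA ler_wpM2r//.
    by rewrite mulr_ge0 ?expR_ge0.
  have K4 : 0 <= Em * rhowd `|w - wh| by rewrite mulr_ge0// ltW.
  lra.
- have [yq gq yqy] := quantize_round (is_g S sh.1 wh uh) hetax.
  exists (yq, 0%N); split => //=.
    by split => //; right; split; rewrite -?ssh.
  rewrite !EV c0/= mulr0 expR0 mulr1.
  have [_ rhoud0 _ _] := hrhoud.
  have := A2jump s.1 sh.1 w wh uh uh Ww Wwh Uu Uu.
  rewrite subrr normr0 rhoud0 addr0 -gE => J.
  have := V_round s'.1 _ _ yqy => Rd.
  (* The counter is reset, so the new weight is 1 and the old weight [e^(a c)] is available to
     absorb [kd]. *)
  have K1 : kd * V s.1 sh.1 <= sigma * (V s.1 sh.1 * expR (a * s.2%:R)).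
    rewrite mulrCA [X in X <= _]mulrC ler_wpM2l//.
    apply: le_trans (Hsj _ cz) _; by rewrite ler_wpM2r ?expR_ge0.
  have K2 : rhowd `|w - wh| <= Em * rhowd `|w - wh| by rewrite ler_peMl.
  have K3 : gammah etax <= Em * gammah etax by rewrite ler_peMl.
  have K4 : 0 <= Em * C1 * rhowc `|w - wh| by rewrite mulr_ge0// ltW.
  lra.
Qed.
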